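(* Let $F=u\,\phi(r,s)$ be a spherically symmetric Finsler metric on a domain $\Omega\subseteq\mathbb{R}^n$, where $r=|x|$, $u=|y|$, $s=\frac{\langle x,y\rangle}{|y|}$, and let \[Q=\frac{1}{2r}\,\frac{-\phi_r+s\phi_{rs}+r\phi_{ss}}{\phi-s\phi_s+(r^2-s^2)\phi_{ss}},\qquad P=-\frac{1}{\phi}\big(s\phi+(r^2-s^2)\phi_s\big)Q+\frac{1}{2r\phi}(s\phi_r+r\phi_s).\] Then $(\Omega,F)$ is an Einstein metric if and only if there is a function $K=K(r)$ such that \[(n-1)R_1+(r^2-s^2)R_3=(n-1)K\phi^2,\] where \[R_1=2Q-\frac{s}{r}P_r-P_s+2(r^2-s^2)P_sQ+P^2+2sPQ\] and \[R_3=\frac{2}{r}Q_r-Q_{ss}-\frac{s}{r}Q_{rs}+2(r^2-s^2)QQ_{ss}+4Q^2-(r^2-s^2)Q_s^2-2sQQ_s.\]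
   Context: Here $\langle\cdot,\cdot\rangle$ and $|\cdot|$ are the standard Euclidean inner product and norm, $x\in\Omega$, and $y\in T_x\Omega\cong\mathbb{R}^n$ is nonzero. A Finsler metric $F=F(x,y)$ on $\Omega$ is called spherically symmetric if it is invariant under all rotations of $\mathbb{R}^n$; then $F=u\,\phi(r,s)$ for a positive function $\phi$ of two variables. Subscripts $r,s$ denote partial derivatives. With $g_{ij}=\frac12\frac{\partial^2F^2}{\partial y^i\partial y^j}$ and inverse $g^{ij}$, the geodesic spray coefficients are $G^i=\frac14 g^{il}\{(F^2)_{x^ky^l}y^k-(F^2)_{x^l}\}$ (summation convention); for spherically symmetric $F$ they equal $G^i=uPy^i+u^2Qx^i$ with the $P,Q$ of the claim. The Riemann curvature is \[R^i_{\ j}=2(G^i)_{x^j}-y^k(G^i)_{x^ky^j}+2G^k(G^i)_{y^ky^j}-(G^i)_{y^k}(G^k)_{y^j},\] and the Ricci curvature is its trace $\mathbf{Ric}=R^i_{\ i}$. A Finsler metric $F$ on an $n$-dimensional manifold is an Einstein metric if there is a function $K(x)$ of the point such that $\mathbf{Ric}=(n-1)K(x)F^2$. *)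

(* Defs.v *)
From HB Require Import structures.
From mathcomp Require Import all_boot all_order all_algebra.
From mathcomp Require Import all_classical all_reals all_analysis.

Set Implicit Arguments.
Unset Strict Implicit.
Unset Printing Implicit Defensive.

Import Order.TTheory GRing.Theory Num.Theory.
Import numFieldNormedType.Exports.

Local Open Scope classical_set_scope.
Local Open Scope ring_scope.

(* The library norm on ['rV[R]_n] is the sup norm; it induces the usual topology
   but is not the Euclidean norm, hence the definitions below. *)
Definition dotp (R : realType) (n : nat) (x y : 'rV[R]_n) : R :=
  \sum_(i < n) x 0 i * y 0 i.

Definition enorm (R : realType) (n : nat) (x : 'rV[R]_n) : R :=
  Num.sqrt (dotp x x).

(* [f] has continuous iterated directional derivatives up to order [k] on the
   (open) set [U]. *)
Fixpoint Ck (R : realType) (V : normedModType R) (k : nat) (U : set V)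
    (f : V -> R) : Prop :=
  match k with
  | 0 => forall p, U p -> {for p, continuous f}
  | k'.+1 => (forall p v, U p -> derivable f p v) /\
             (forall v, Ck k' U ('D_v f))
  end.

Definition smooth_on (R : realType) (V : normedModType R) (U : set V)
    (f : V -> R) : Prop := forall k, Ck k U f.

Definition is_domain (R : realType) (n : nat) (Omega : set 'rV[R]_n) : Prop :=
  [/\ open Omega, connected Omega & Omega !=set0].

Section Finsler.
Variables (R : realType) (n : nat).

(* Functions on the tangent bundle of an open subset of R^n, in the global
   coordinates (x, y). *)
Local Notation tfun := ('rV[R]_n -> 'rV[R]_n -> R).

Definition dx (i : 'I_n) (f : tfun) : tfun :=
  fun x y => 'D_(delta_mx 0 i) (fun z => f z y) x.

Definition dy (i : 'I_n) (f : tfun) : tfun :=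
  fun x y => 'D_(delta_mx 0 i) (f x) y.

Definition sqf (F : tfun) : tfun := fun x y => F x y ^+ 2.

Definition fundamental_tensor (F : tfun) (x y : 'rV[R]_n) : 'M[R]_n :=
  \matrix_(i, j) (2^-1 * dy j (dy i (sqf F)) x y).

Definition slit_bundle (Omega : set 'rV[R]_n) : set ('rV[R]_n * 'rV[R]_n) :=
  [set p | Omega p.1 /\ p.2 != 0].

Definition is_finsler (Omega : set 'rV[R]_n) (F : tfun) : Prop :=
  [/\ forall x y : 'rV[R]_n, Omega x -> 0 <= F x y,
      smooth_on (slit_bundle Omega) (fun p : 'rV[R]_n * 'rV[R]_n => F p.1 p.2),
      forall (x y : 'rV[R]_n) (c : R), Omega x -> 0 < c -> F x (c *: y) = c * F x y &
      forall x y v : 'rV[R]_n, Omega x -> y != 0 -> v != 0 ->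
        0 < (v *m fundamental_tensor F x y *m v^T) 0 0].

Definition spray (F : tfun) (i : 'I_n) : tfun := fun x y =>
  4^-1 * \sum_(l < n) invmx (fundamental_tensor F x y) i l *
    (\sum_(k < n) dy l (dx k (sqf F)) x y * y 0 k - dx l (sqf F) x y).

Definition riemann (F : tfun) (i j : 'I_n) : tfun := fun x y =>
  let G := spray F in
  2 * dx j (G i) x y
  - \sum_(k < n) y 0 k * dy j (dx k (G i)) x y
  + 2 * \sum_(k < n) G k x y * dy j (dy k (G i)) x y
  - \sum_(k < n) dy k (G i) x y * dy j (G k) x y.

Definition ricci (F : tfun) : tfun := fun x y =>
  \sum_(i < n) riemann F i i x y.

Definition is_einstein (Omega : set 'rV[R]_n) (F : tfun) : Prop :=
  exists K : 'rV[R]_n -> R, forall x y : 'rV[R]_n, Omega x -> y != 0 ->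
    ricci F x y = (n%:R - 1) * K x * F x y ^+ 2.

Definition is_rotation (A : 'M[R]_n) : Prop := A *m A^T = 1%:M /\ \det A = 1.

(* Vectors are rows, so the rotation [A] acts by [x |-> x *m A].  If [Omega] is
   itself rotation-invariant the guard [Omega (x *m A)] is automatic. *)
Definition spherically_symmetric (Omega : set 'rV[R]_n) (F : tfun) : Prop :=
  forall A, is_rotation A -> forall x y : 'rV[R]_n, Omega x -> Omega (x *m A) ->
    F (x *m A) (y *m A) = F x y.

(* The values (r, s) = (|x|, <x, y> / |y|) taken over [Omega].  The origin is
   left out because the formulas for P, Q, R_1, R_3 divide by r. *)
Definition rs_range (Omega : set 'rV[R]_n) : set (R * R) :=
  [set p | exists x y : 'rV[R]_n, [/\ Omega x, x != 0, y != 0 &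
                           p = (enorm x, dotp x y / enorm y)]].

(* [F = u phi(r, s)] with [phi] positive.  Only the values of [phi] on
   |s| <= r matter; smoothness is asked on a neighbourhood of [rs_range] so that
   the partial derivatives make sense also on the boundary |s| = r. *)
Definition spherical_form (Omega : set 'rV[R]_n) (F : tfun) (phi : R -> R -> R)
    : Prop :=
  [/\ forall x y : 'rV[R]_n, Omega x -> y != 0 ->
        0 < phi (enorm x) (dotp x y / enorm y),
      exists U : set (R * R),
        [/\ open U, rs_range Omega `<=` U &
            smooth_on U (fun p : R * R => phi p.1 p.2)] &
      forall x y : 'rV[R]_n, Omega x ->
        F x y = enorm y * phi (enorm x) (dotp x y / enorm y)].

End Finsler.

Section ProfileFunctions.
Variable R : realType.
Implicit Types (phi f : R -> R -> R) (r s : R).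

Definition dr f : R -> R -> R := fun r s => derive1 (fun t => f t s) r.
Definition ds f : R -> R -> R := fun r s => derive1 (f r) s.

Definition Qfun phi : R -> R -> R := fun r s =>
  (2 * r)^-1 *
  ((- dr phi r s + s * ds (dr phi) r s + r * ds (ds phi) r s) /
   (phi r s - s * ds phi r s + (r ^+ 2 - s ^+ 2) * ds (ds phi) r s)).

Definition Pfun phi : R -> R -> R := fun r s =>
  - (phi r s)^-1 * (s * phi r s + (r ^+ 2 - s ^+ 2) * ds phi r s) * Qfun phi r s
  + (2 * r * phi r s)^-1 * (s * dr phi r s + r * ds phi r s).

Definition R1fun phi : R -> R -> R := fun r s =>
  let P := Pfun phi in let Q := Qfun phi in
  2 * Q r s - s / r * dr P r s - ds P r s
  + 2 * (r ^+ 2 - s ^+ 2) * ds P r s * Q r s + P r s ^+ 2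
  + 2 * s * P r s * Q r s.

Definition R3fun phi : R -> R -> R := fun r s =>
  let Q := Qfun phi in
  2 / r * dr Q r s - ds (ds Q) r s - s / r * ds (dr Q) r s
  + 2 * (r ^+ 2 - s ^+ 2) * Q r s * ds (ds Q) r s + 4 * Q r s ^+ 2
  - (r ^+ 2 - s ^+ 2) * ds Q r s ^+ 2 - 2 * s * Q r s * ds Q r s.

End ProfileFunctions.

(* Main.v *)
(* Off the origin, [F ^ 2 = u ^ 2 phi(r, s) ^ 2] and all tensors involved are
   combinations of [delta_ij] and of products of the coordinates of [x] and [y],
   with coefficients depending on [u], [r] and [s] only.  Positive definiteness
   makes the denominator of [Q] nonzero and the fundamental tensor [g]
   invertible, so that the spray is identified by contracting [u P y + u^2 Q x]
   with [g] rather than by inverting [g].  Differentiating it twice and tracing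
   gives [ricci F x y = u^2 ((n - 1) R_1 + (r^2 - s^2) R_3)] for [n >= 2] and
   [x != 0].  For a fixed [x != 0] the angle [s] ranges over all of [-r, r], so
   the Einstein factor depends on [|x|] only; at the origin it is recovered from
   the continuity of the Ricci curvature.  In dimension one both sides of the
   equivalence hold trivially. *)
Require Import Defs.
From mathcomp Require Import all_boot all_order all_algebra.
From mathcomp Require Import all_classical all_reals all_analysis.
From mathcomp Require Import ring lra.

Import Order.TTheory GRing.Theory Num.Theory.
Import numFieldNormedType.Exports.

Local Open Scope classical_set_scope.
Local Open Scope ring_scope.

Set Implicit Arguments.
Unset Strict Implicit.
Unset Printing Implicit Defensive.

(** * Smooth functions *)

(** Smoothness is expressed by iterated directional derivatives, which by themselves obey no chain
    rule. The unknown functions enter only as functions of two real variables evaluated at [(r, s)],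
    so total differentiability is needed in the plane alone, where the mean value theorem extracts
    it from continuous partial derivatives. The nonvanishing of the denominator of [Q] is tested on
    vectors orthogonal to [y] when [x] and [y] are dependent, hence [n >= 2]. In dimension one
    [|s| = r] always holds, [F] says nothing about the derivatives of [phi] across that set, and
    [P], [Q] no longer describe the spray; the curvature is then computed directly. Every tensor is
    a combination of a Kronecker delta, [x] and [y] in the index being summed, so a contraction
    costs only inner products. The trace thereby becomes a rational identity in [u], [r], [s], [n]
    and the derivatives of [P] and [Q], all treated as independent variables. The closed formula
    divides by [r], while the Einstein condition also concerns the origin; for this reason the Ricci
    curvature is shown to be smooth from its definition as well. *)

Section DirectionalDerivatives.
Variables (R : realType) (V : normedModType R).
Implicit Types (U : set V) (f g : V -> R).

Lemma is_derive_eq_on U f g x v (df : R) : open U -> U x ->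
  (forall z, U z -> f z = g z) -> is_derive x v f df -> is_derive x v g df.
Proof.
move=> oU Ux fg; apply: near_eq_is_derive.
by apply: filterS (open_nbhs_nbhs (conj oU Ux)).
Qed.

Lemma derive_eq_on U f g x v : open U -> U x ->
  (forall z, U z -> f z = g z) -> 'D_v f x = 'D_v g x.
Proof.
move=> oU Ux fg; apply: near_eq_derive.
by apply: filterS (open_nbhs_nbhs (conj oU Ux)).
Qed.

Lemma is_derive_const (c : R) (x v : V) : is_derive x v (fun _ => c) 0.
Proof. exact: is_derive_cst. Qed.

Lemma is_derive_to f x v (d d' : R) : is_derive x v f d -> d = d' ->
  is_derive x v f d'.
Proof. by move=> ? <-. Qed.

Lemma is_derive_add f g x v (df dg : R) : is_derive x v f df ->
  is_derive x v g dg -> is_derive x v (fun z => f z + g z) (df + dg).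
Proof. by move=> ? ?; exact: is_deriveD. Qed.

Lemma is_derive_mul f g x v (df dg : R) : is_derive x v f df ->
  is_derive x v g dg ->
  is_derive x v (fun z => f z * g z) (df * g x + f x * dg).
Proof.
move=> [dfx dfE] [dgx dgE]; split; first exact: derivableM.
by rewrite (deriveM dfx dgx) dfE dgE /GRing.scale /= addrC mulrC.
Qed.

Lemma is_derive_opp f x v (df : R) : is_derive x v f df ->
  is_derive x v (fun z => - f z) (- df).
Proof. by move=> ?; exact: is_deriveN. Qed.

Lemma is_derive_inv f x v (df : R) : f x != 0 -> is_derive x v f df ->
  is_derive x v (fun z => (f z)^-1) (- df / f x ^+ 2).
Proof.
move=> fx0 [dfx dfE]; split; first exact: derivableV.
by rewrite deriveV // dfE /GRing.scale /= mulrC mulNr mulrN.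
Qed.

Lemma is_derive_expn f k x v (df : R) : is_derive x v f df ->
  is_derive x v (fun z => f z ^+ k) (k%:R * f x ^+ k.-1 * df).
Proof.
move=> dfx; elim: k => [|k IH] /=.
  under eq_fun do rewrite expr0.
  by rewrite !mul0r; exact: is_derive_const.
under eq_fun do rewrite exprS.
apply: is_derive_to (is_derive_mul dfx IH) _.
by case: k {IH} => [|k] /=; rewrite ?exprS ?expr0 -?[in RHS]natr1; ring.
Qed.

(** Coordinates, inner products and [|x|^2] restrict to polynomials of degree at most two on every
    line, so their derivatives follow from an algebraic expansion. *)
Lemma is_derive_quadratic f x v (c d : R) :
  (forall h, f (h *: v + x) = f x + h * c + h ^+ 2 * d) -> is_derive x v f c.
Proof.
move=> fE.
have lim_c : (fun h => h^-1 *: (f (h *: v + x) - f x)) @ 0^' --> c.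
  have E : (fun h => c + h * d) @ 0^' --> c.
    rewrite -[X in _ --> X]addr0 -[X in c + X](mul0r d).
    apply: cvgD; first exact: cvg_cst.
    apply: cvgM; last exact: cvg_cst.
    exact: nbhs_dnbhs.
  apply: cvg_trans E; apply: near_eq_cvg; near=> h.
  have h0 : h != 0 by near: h; exact: nbhs_dnbhs_neq.
  rewrite fE /GRing.scale /=; field.
  exact: h0.
split; first by apply/cvg_ex; exists c.
exact: cvg_lim lim_c.
Unshelve. all: by end_near. Qed.

(** Gives access to one-variable results, here the chain rule with the square root. *)
Lemma is_derive_line (f : V -> R) (p v : V) (df : R) :
  is_derive p v f df <-> is_derive (0 : R) 1 (fun h : R => f (h *: v + p)) df.
Proof.
have E : (fun h : R => h^-1 *: (f (h *: v + p) - f p)) =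
   (fun h : R => h^-1 *: (f ((h *: (1 : R) + 0 : R) *: v + p) -
      f ((0 : R) *: v + p))).
  by apply/funext => h; rewrite addr0 scale0r add0r [h *: (1 : R)]mulr1.
by split=> -[dvf dfE]; split; move: dvf dfE; rewrite /derivable /derive -?E ?E.
Qed.

Lemma is_derive_sqrt_comp (f : V -> R) (p v : V) (df : R) :
  0 < f p -> is_derive p v f df ->
  is_derive p v (fun q => Num.sqrt (f q)) (df / (2 * Num.sqrt (f p))).
Proof.
move=> fp0 /is_derive_line fdf; apply/is_derive_line.
have ds : is_derive (f ((0 : R) *: v + p)) 1 Num.sqrt (2 * Num.sqrt (f p))^-1.
  by rewrite scale0r add0r; exact: is_derive1_sqrt.
by rewrite mulrC; exact: is_derive1_comp ds fdf.
Qed.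

Lemma open_nonzero : open [set z : V | z != 0].
Proof.
rewrite openE => z z0; apply/nbhs_ballP; exists `|z| => /=.
  by rewrite normr_gt0.
move=> w; rewrite -ball_normE /= => zw; apply/eqP => w0.
by move: zw; rewrite w0 subr0 ltxx.
Qed.

End DirectionalDerivatives.

(** * Closure properties of smooth functions *)

Section Smooth.
Variables (R : realType) (V : normedModType R).
Implicit Types (U : set V) (f g : V -> R).

Lemma smooth_continuous U f p : smooth_on U f -> U p -> {for p, continuous f}.
Proof. by move=> /(_ 0%N); apply. Qed.

Lemma smooth_derivable U f p v : smooth_on U f -> U p -> derivable f p v.
Proof. by move=> /(_ 1%N) [+ _]; apply. Qed.

Lemma smooth_is_derive U f p v : smooth_on U f -> U p ->
  is_derive p v f ('D_v f p).
Proof. by move=> sf Up; apply/derivableP; exact: smooth_derivable Up. Qed.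

Lemma smooth_derive U f v : smooth_on U f -> smooth_on U ('D_v f).
Proof. by move=> sf k; have [_] := sf k.+1; apply. Qed.

Lemma smooth_sub U U' f : U' `<=` U -> smooth_on U f -> smooth_on U' f.
Proof.
move=> sub sf k; move: (sf k); elim: k f {sf} => [|k IH] f /=.
  by move=> cf p /sub; exact: cf.
by move=> [df cf]; split=> [p v /sub /df //|v]; exact/IH/cf.
Qed.

Lemma Ck_ext k U f g : open U -> (forall z, U z -> f z = g z) ->
  Ck k U f -> Ck k U g.
Proof.
move=> oU; elim: k f g => [|k IH] f g fg /=.
  move=> cf p Up; rewrite /prop_for /continuous_at -fg //.
  apply: cvg_trans (cf p Up); apply: near_eq_cvg.
  by apply: filterS (open_nbhs_nbhs (conj oU Up)) => z /fg ->.
move=> [df cf]; split=> [p v Up|v].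
  have fp := df p v Up.
  exact: (@ex_derive _ _ _ _ _ _ _ (is_derive_eq_on oU Up fg (derivableP fp))).
by apply: IH (cf v) => z Uz; exact: derive_eq_on fg.
Qed.

Lemma smooth_ext U f g : open U -> (forall z, U z -> f z = g z) ->
  smooth_on U f -> smooth_on U g.
Proof. by move=> oU fg sf k; exact: Ck_ext (sf k). Qed.

(** Higher derivatives need no explicit formula once the function lies in a class that is stable, up
    to equality on [U], under all directional derivatives. *)
Lemma smooth_coind U (S : (V -> R) -> Prop) : open U ->
  (forall f, S f -> [/\ forall p, U p -> {for p, continuous f},
     forall p v, U p -> derivable f p v &
     forall v, exists2 g, S g & forall z, U z -> g z = 'D_v f z]) ->
  forall f, S f -> smooth_on U f.
Proof.
move=> oU HS f Sf k; elim: k f Sf => [|k IH] f /HS [cf df Df] //=.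
split=> // v; have [g Sg gE] := Df v.
exact: Ck_ext gE (IH _ Sg).
Qed.

Lemma smooth_cst U (c : R) : open U -> smooth_on U (fun _ => c).
Proof.
move=> oU; apply: (smooth_coind oU (S := fun f => exists c, f = fun _ => c));
  last by exists c.
move=> _ [{}c ->]; split=> [p _|p v _|v].
- exact: cvg_cst.
- exact: derivable_cst.
- exists (fun _ => 0); first by exists 0.
  by move=> z _; rewrite (@derive_val _ _ _ _ _ _ _ (is_derive_const c z v)).
Qed.

Lemma Ck_add k U f g : open U -> Ck k U f -> Ck k U g ->
  Ck k U (fun z => f z + g z).
Proof.
move=> oU; elim: k f g => [|k IH] f g /=.
  by move=> cf cg p Up; apply: cvgD; [exact: cf|exact: cg].
move=> [df cf] [dg cg]; split=> [p v Up|v].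
  by apply: derivableD; [exact: df|exact: dg].
apply: (Ck_ext oU) (IH _ _ (cf v) (cg v)) => z Uz; apply/esym/derive_val.
by apply: is_derive_add; apply/derivableP; [exact: df|exact: dg].
Qed.

Lemma smooth_add U f g : open U -> smooth_on U f -> smooth_on U g ->
  smooth_on U (fun z => f z + g z).
Proof. by move=> oU sf sg k; exact: Ck_add. Qed.

Lemma smooth_opp U f : open U -> smooth_on U f -> smooth_on U (fun z => - f z).
Proof.
move=> oU sf; apply: (smooth_coind oU (S := fun h => exists2 a, smooth_on U a &
  h = fun z => - a z)); last by exists f.
move=> _ [a sa ->]; split=> [p Up|p v Up|v].
- by apply: cvgN; exact: smooth_continuous Up.
- by apply: derivableN; exact: smooth_derivable Up.
- exists (fun z => - 'D_v a z).
    by exists ('D_v a) => //; exact: smooth_derive.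
  move=> z Uz; apply/esym/derive_val.
  by apply: is_derive_opp; exact: smooth_is_derive Uz.
Qed.

Lemma smooth_sub_fun U f g : open U -> smooth_on U f -> smooth_on U g ->
  smooth_on U (fun z => f z - g z).
Proof. by move=> oU sf sg; apply: smooth_add => //; exact: smooth_opp. Qed.

Lemma smooth_sum (I : Type) (r : seq I) (P : pred I) U (f : I -> V -> R) :
  open U -> (forall i, smooth_on U (f i)) ->
  smooth_on U (fun z => \sum_(i <- r | P i) f i z).
Proof.
move=> oU sf; elim: r => [|i r IH].
  by under eq_fun do rewrite big_nil; exact: smooth_cst.
under eq_fun do rewrite big_cons; case: (P i) => //.
exact: smooth_add.
Qed.

(** The Leibniz rule keeps one factor undifferentiated, and [Ck k.+1] does not contain [Ck k] by
    definition; the induction therefore carries full smoothness of both factors. *)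
Lemma smooth_mul U f g : open U -> smooth_on U f -> smooth_on U g ->
  smooth_on U (fun z => f z * g z).
Proof.
move=> oU sf sg k; elim: k f g sf sg => [|k IH] f g sf sg /=.
  by move=> p Up; apply: cvgM; exact: smooth_continuous Up.
split=> [p v Up|v].
  by apply: derivableM; exact: smooth_derivable Up.
have sDf := smooth_derive v sf; have sDg := smooth_derive v sg.
apply: (Ck_ext oU) (Ck_add oU (IH _ _ sDf sg) (IH _ _ sf sDg)) => z Uz.
apply/esym/derive_val.
by apply: is_derive_mul; exact: smooth_is_derive Uz.
Qed.

Lemma smooth_prod (I : Type) (r : seq I) (P : pred I) U (f : I -> V -> R) :
  open U -> (forall i, smooth_on U (f i)) ->
  smooth_on U (fun z => \prod_(i <- r | P i) f i z).
Proof.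
move=> oU sf; elim: r => [|i r IH].
  by under eq_fun do rewrite big_nil; exact: smooth_cst.
under eq_fun do rewrite big_cons; case: (P i) => //.
exact: smooth_mul.
Qed.

Lemma smooth_exp U f m : open U -> smooth_on U f ->
  smooth_on U (fun z => f z ^+ m).
Proof.
move=> oU sf; elim: m => [|m IH].
  by under eq_fun do rewrite expr0; exact: smooth_cst.
by under eq_fun do rewrite exprS; exact: smooth_mul.
Qed.

(** The derivative of a reciprocal is not a reciprocal, but the functions [g * f^-m] with [g] smooth
    form a stable class: differentiation turns [g] into [g' f - m g f'] and [m] into [m + 1]. *)
Lemma smooth_inv U f : open U -> smooth_on U f ->
  (forall z, U z -> f z != 0) -> smooth_on U (fun z => (f z)^-1).
Proof.
move=> oU sf f0.
have DE v m g z : smooth_on U g -> U z ->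
    is_derive z v (fun z => g z * (f z)^-1 ^+ m)
      (('D_v g z * f z - m%:R * g z * 'D_v f z) * (f z)^-1 ^+ m.+1).
  move=> sg Uz; have fz0 := f0 z Uz.
  apply: is_derive_to.
    apply: is_derive_mul; first exact: smooth_is_derive Uz.
    apply: is_derive_expn; apply: is_derive_inv => //.
    exact: smooth_is_derive Uz.
  case: m => [|m] /=; rewrite ?expr0 ?exprS; field.
    exact: fz0.
  exact: fz0.
apply: (smooth_coind oU (S := fun h => exists g m, smooth_on U g /\
   h = fun z => g z * (f z)^-1 ^+ m)) => //; last first.
  exists (fun _ => 1), 1%N; split; first exact: smooth_cst.
  by under [RHS]eq_fun do rewrite mul1r expr1.
move=> _ [g [m [sg ->]]]; split=> [p Up|p v Up|v].
- apply: cvgM; first exact: smooth_continuous Up.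
  apply: (@continuous_comp _ _ _ (fun z => (f z)^-1) (fun t => t ^+ m)).
    by apply: cvgV; [exact: f0|exact: smooth_continuous Up].
  exact: exprn_continuous.
- exact: (@ex_derive _ _ _ _ _ _ _ (DE v m g p sg Up)).
- exists (fun z => ('D_v g z * f z - m%:R * g z * 'D_v f z) *
      (f z)^-1 ^+ m.+1); last by move=> z Uz; apply/esym/derive_val/DE.
  eexists; exists m.+1; split; last reflexivity.
  apply: smooth_sub_fun => //.
    by apply: smooth_mul => //; exact: smooth_derive.
  apply: smooth_mul => //; last exact: smooth_derive.
  by apply: smooth_mul => //; exact: smooth_cst.
Qed.

Lemma smooth_linear U f : open U -> continuous f ->
  (forall h v x, f (h *: v + x) = h * f v + f x) -> smooth_on U f.
Proof.
move=> oU cf lf.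
have DE v x : is_derive x v f (f v).
  by apply: (is_derive_quadratic (d := 0)) => h; rewrite lf mulr0 addr0 addrC.
move=> [|k]; first by move=> p _; exact: cf.
split=> [p v _|v]; first exact: (@ex_derive _ _ _ _ _ _ _ (DE v p)).
apply: Ck_ext (smooth_cst (f v) oU k) => // z _.
by apply/esym/derive_val.
Qed.

Lemma open_neq0 U f : open U -> smooth_on U f ->
  open (U `&` [set z | f z != 0]).
Proof.
move=> oU sf; rewrite openE => p [Up fp0]; rewrite /interior.
have cf := smooth_continuous sf Up.
apply: filterI; first exact: (open_nbhs_nbhs (conj oU Up)).
apply: (cf [set t : R | t != 0]).
by apply: open_nbhs_nbhs; split=> //; exact: open_neq.
Qed.

End Smooth.

(** * Chain rule for functions of two real variables *)

Section ChainRule.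
Variable R : realType.
Implicit Types (U : set (R * R)) (h : R * R -> R).

(** Distances to [a] make the statement indifferent to the order of [a] and [b]; the symmetric
    interval in the hypothesis costs nothing inside a ball. *)
Lemma MVT_between (f df : R -> R) (a b : R) :
  (forall t, `|t - a| <= `|b - a| -> is_derive t 1 f (df t)) ->
  exists2 c, `|c - a| <= `|b - a| & f b - f a = df c * (b - a).
Proof.
move=> fdf.
have cf (c d : R) : (forall t, t \in `[c, d] -> `|t - a| <= `|b - a|) ->
    {within `[c, d], continuous f}.
  move=> cdab; apply: derivable_within_continuous => t /cdab /fdf [].
  by [].
have [ab|ba] := leP a b.
  have le_ab t : t \in `[a, b] -> `|t - a| <= `|b - a|.
    by rewrite in_itv /= => /andP[? ?]; rewrite !ger0_norm; lra.
  have dab t : t \in `]a, b[ -> is_derive t 1 f (df t).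
    by move=> tab; apply/fdf/le_ab/subset_itv_oo_cc.
  by have [c /le_ab ? ?] := MVT_segment ab dab (cf _ _ le_ab); exists c.
have le_ba t : t \in `[b, a] -> `|t - a| <= `|b - a|.
  by rewrite in_itv /= => /andP[? ?]; rewrite !ler0_norm; lra.
have dba t : t \in `]b, a[ -> is_derive t 1 f (df t).
  by move=> tab; apply/fdf/le_ba/subset_itv_oo_cc.
have [c /le_ba ? E] := MVT_segment (ltW ba) dba (cf _ _ le_ba).
by exists c => //; lra.
Qed.

(* Carathéodory's form of total differentiability, from the mean value theorem
   along the two edges joining [p] to [q]. *)
Lemma smooth_caratheodory U h p : open U -> smooth_on U h -> U p ->
  exists A B : R * R -> R,
    [/\ A @ p --> 'D_(1, 0) h p, B @ p --> 'D_(0, 1) h p &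
     \forall q \near p,
       h q - h p = A q * (q.1 - p.1) + B q * (q.2 - p.2)].
Proof.
move=> oU sh Up.
have /nbhs_ballP[e /= e0 Ue] := open_nbhs_nbhs (conj oU Up).
have Uclose (q c : R * R) : ball p e q -> `|c.1 - p.1| <= `|q.1 - p.1| ->
    `|c.2 - p.2| <= `|q.2 - p.2| -> U c.
  case=> q1 q2 c1 c2; apply: Ue; split; rewrite /ball /= distrC.
    by apply: le_lt_trans c1 _; rewrite distrC.
  by apply: le_lt_trans c2 _; rewrite distrC.
have edge1 q : exists c, ball p e q -> `|c - p.1| <= `|q.1 - p.1| /\
    h q - h (p.1, q.2) = 'D_(1, 0) h (c, q.2) * (q.1 - p.1).
  (* Outside the ball [0] is a dummy value: [choice] asks for a point for every [q]. *)
  have [bq|nbq] := pselect (ball p e q); last by exists 0.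
  have [t tq|c cq E] := @MVT_between (fun t => h (t, q.2))
    (fun t => 'D_(1, 0) h (t, q.2)) p.1 q.1.
    have Ut : U (t, q.2) by apply: Uclose bq _ _.
    have [dh <-] := smooth_is_derive ((1, 0) : R * R) sh Ut.
    have E : (fun k : R => k^-1 *: (h (k *: ((1, 0) : R * R) + (t, q.2)) -
        h (t, q.2))) =
       (fun k : R => k^-1 *: (h (k *: 1 + t, q.2) - h (t, q.2))).
      apply/funext => k; congr (_ *: (h _ - _)).
      by congr pair; rewrite /= scaler0 add0r.
    by split; [rewrite /derivable -E|rewrite /derive -E].
  by exists c => _; split=> //; rewrite -E -surjective_pairing.
have edge2 q : exists c, ball p e q -> `|c - p.2| <= `|q.2 - p.2| /\
    h (p.1, q.2) - h p = 'D_(0, 1) h (p.1, c) * (q.2 - p.2).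
  have [bq|nbq] := pselect (ball p e q); last by exists 0.
  have [t tq|c cq E] := @MVT_between (fun t => h (p.1, t))
    (fun t => 'D_(0, 1) h (p.1, t)) p.2 q.2.
    have Ut : U (p.1, t) by apply: Uclose bq _ _ => //=; rewrite subrr normr0.
    have [dh <-] := smooth_is_derive ((0, 1) : R * R) sh Ut.
    have E : (fun k : R => k^-1 *: (h (k *: ((0, 1) : R * R) + (p.1, t)) -
        h (p.1, t))) =
       (fun k : R => k^-1 *: (h (p.1, k *: 1 + t) - h (p.1, t))).
      apply/funext => k; congr (_ *: (h _ - _)).
      by congr pair; rewrite /= scaler0 add0r.
    by split; [rewrite /derivable -E|rewrite /derive -E].
  by exists c => _; split=> //; rewrite -E -surjective_pairing.
have [c1 c1P] := choice edge1; have [c2 c2P] := choice edge2.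
have near_ball : \forall q \near p, ball p e q by exact: nbhsx_ballx.
have cvgp1 : (fun q : R * R => q.1) @ p --> p.1 by exact: cvg_fst.
have cvgp2 : (fun q : R * R => q.2) @ p --> p.2 by exact: cvg_snd.
(* The intermediate points are no farther from [p] than [q] in each coordinate, so they tend to [p]
   with it. *)
have squeeze (g : R * R -> R) (l : R) (k : R * R -> R) : k @ p --> l ->
    (\forall q \near p, `|g q - l| <= `|k q - l|) -> g @ p --> l.
  move=> kl gk; apply/cvgrPdist_le => d d0.
  have /cvgrPdist_le/(_ d d0) kd := kl.
  near=> q; rewrite distrC; apply: le_trans (_ : `|k q - l| <= d).
    by near: q.
  by rewrite distrC; near: q.
have cvg_pt (g1 g2 : R * R -> R) v : g1 @ p --> p.1 -> g2 @ p --> p.2 ->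
    (fun q => 'D_v h (g1 q, g2 q)) @ p --> 'D_v h p.
  move=> g1p g2p; have cp := smooth_continuous (smooth_derive v sh) Up.
  have gp : (fun q => (g1 q, g2 q)) @ p --> (p.1, p.2).
    exact: (cvg_pair g1p g2p).
  by move: gp; rewrite -surjective_pairing => gp; exact: cvg_comp gp cp.
exists (fun q => 'D_(1, 0) h (c1 q, q.2)), (fun q => 'D_(0, 1) h (p.1, c2 q)).
split.
- apply: cvg_pt => //; apply: squeeze cvgp1 _.
  by apply: filterS near_ball => q /c1P[].
- apply: cvg_pt; first exact: cvg_cst.
  by apply: squeeze cvgp2 _; apply: filterS near_ball => q /c2P[].
- apply: filterS near_ball => q bq.
  by have [_ <-] := c1P q bq; have [_ <-] := c2P q bq; ring.
Unshelve. all: by end_near. Qed.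

(** Carathéodory's slopes for [h], evaluated along the line through [x], converge because [a] and
    [b] are continuous along it; total differentiability is a matter of the outer function only. *)
Lemma is_derive_comp2 (V : normedModType R) U h (a b : V -> R) x v
    (da db : R) : open U -> smooth_on U h -> U (a x, b x) ->
  is_derive x v a da -> is_derive x v b db ->
  is_derive x v (fun z => h (a z, b z))
    ('D_(1, 0) h (a x, b x) * da + 'D_(0, 1) h (a x, b x) * db).
Proof.
move=> oU sh Ux [dva <-] [dvb <-].
have [A [B [cA cB hAB]]] := smooth_caratheodory oU sh Ux.
have cvg_line (f : V -> R) : derivable f x v ->
    (fun k : R => f (k *: v + x)) @ (0 : R)^' --> f x.
  move=> /derivable1P/derivable1_diffP/differentiable_continuous.
  by move=> /continuous_withinNx; rewrite scale0r add0r.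
have cvg_ab : (fun k : R => (a (k *: v + x), b (k *: v + x))) @ (0 : R)^' -->
    (a x, b x).
  by exact: (cvg_pair (cvg_line _ dva) (cvg_line _ dvb)).
have lim_h : (fun k => k^-1 *: (h (a (k *: v + x), b (k *: v + x)) -
    h (a x, b x))) @ (0 : R)^' -->
    'D_(1, 0) h (a x, b x) * 'D_v a x + 'D_(0, 1) h (a x, b x) * 'D_v b x.
  have E : (fun k => A (a (k *: v + x), b (k *: v + x)) *
      (k^-1 *: (a (k *: v + x) - a x)) + B (a (k *: v + x), b (k *: v + x)) *
      (k^-1 *: (b (k *: v + x) - b x))) @ (0 : R)^' -->
    'D_(1, 0) h (a x, b x) * 'D_v a x + 'D_(0, 1) h (a x, b x) * 'D_v b x.
    apply: cvgD; apply: cvgM.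
    - exact: cvg_comp cvg_ab cA.
    - exact: dva.
    - exact: cvg_comp cvg_ab cB.
    - exact: dvb.
  apply: cvg_trans E; apply: near_eq_cvg.
  near=> k; have /= -> : h (a (k *: v + x), b (k *: v + x)) - h (a x, b x) =
      A (a (k *: v + x), b (k *: v + x)) * (a (k *: v + x) - a x) +
      B (a (k *: v + x), b (k *: v + x)) * (b (k *: v + x) - b x).
    by near: k; exact: cvg_ab _ hAB.
  by rewrite /GRing.scale /=; ring.
split; first by apply/cvg_ex; eexists; exact: lim_h.
exact: cvg_lim lim_h.
Unshelve. all: by end_near. Qed.

End ChainRule.

(** * Functions of |x| and <x, y> / |y| *)

Section Euclidean.
Variables (R : realType) (n : nat).
Implicit Types (x y z : 'rV[R]_n) (a b : R).

Lemma dotpC x y : dotp x y = dotp y x.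
Proof. by apply: eq_bigr => i _; rewrite mulrC. Qed.

Lemma dotpDl x y z : dotp (x + y) z = dotp x z + dotp y z.
Proof. by rewrite -big_split /=; apply: eq_bigr => i _; rewrite mxE mulrDl. Qed.

Lemma dotpZl a x y : dotp (a *: x) y = a * dotp x y.
Proof. by rewrite mulr_sumr; apply: eq_bigr => i _; rewrite mxE mulrA. Qed.

Lemma dotp0l x : dotp 0 x = 0.
Proof. by rewrite -(scale0r x) dotpZl mul0r. Qed.

Lemma dotpDr x y z : dotp x (y + z) = dotp x y + dotp x z.
Proof. by rewrite dotpC dotpDl !(dotpC x). Qed.

Lemma dotpZr a x y : dotp x (a *: y) = a * dotp x y.
Proof. by rewrite dotpC dotpZl dotpC. Qed.

Lemma dotp_delta x i : dotp x (delta_mx 0 i) = x 0 i.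
Proof.
rewrite /dotp (bigD1 i) //= big1 ?addr0 => [|j ji]; rewrite mxE eqxx.
  by rewrite eqxx mulr1.
by rewrite (negbTE ji) mulr0.
Qed.

Lemma dotp_ge0 x : 0 <= dotp x x.
Proof. by apply: sumr_ge0 => i _; rewrite -expr2 sqr_ge0. Qed.

Lemma dotp_eq0 x : (dotp x x == 0) = (x == 0).
Proof.
apply/eqP/eqP => [xx0|->]; last first.
  by rewrite dotp0l.
apply/rowP => i; rewrite mxE; apply/eqP; rewrite -[_ == 0]sqrf_eq0 expr2.
have sq_ge0 (j : 'I_n) : true -> 0 <= x 0 j * x 0 j.
  by rewrite -expr2 sqr_ge0.
by rewrite (psumr_eq0P sq_ge0 xx0).
Qed.

Lemma dotp_gt0 x : x != 0 -> 0 < dotp x x.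
Proof. by move=> x0; rewrite lt_neqAle eq_sym dotp_eq0 x0 dotp_ge0. Qed.

Lemma sqr_enorm x : enorm x ^+ 2 = dotp x x.
Proof. by rewrite sqr_sqrtr // dotp_ge0. Qed.

Lemma enorm_gt0 x : x != 0 -> 0 < enorm x.
Proof. by move=> x0; rewrite sqrtr_gt0 dotp_gt0. Qed.

Lemma enorm_neq0 x : x != 0 -> enorm x != 0.
Proof. by move=> /enorm_gt0/lt0r_neq0. Qed.

Lemma is_derive_dotpl x y i :
  is_derive x (delta_mx 0 i) (fun z => dotp z y) (y 0 i).
Proof.
apply: (is_derive_quadratic (d := 0)) => h.
by rewrite dotpDl dotpZl dotpC dotp_delta; ring.
Qed.

Lemma is_derive_dotpr x y i :
  is_derive y (delta_mx 0 i) (fun z => dotp x z) (x 0 i).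
Proof.
under eq_fun do rewrite dotpC.
exact: is_derive_dotpl.
Qed.

Lemma is_derive_coord x i k :
  is_derive x (delta_mx 0 i) (fun z => z 0 k) (k == i)%:R.
Proof.
apply: (is_derive_quadratic (d := 0)) => h.
by rewrite !mxE eqxx /=; ring.
Qed.

Lemma is_derive_enorm x i : x != 0 ->
  is_derive x (delta_mx 0 i) (fun z => enorm z) (x 0 i / enorm x).
Proof.
move=> x0; apply: is_derive_to.
  apply: is_derive_sqrt_comp; first exact: dotp_gt0.
  apply: (is_derive_quadratic (c := 2 * x 0 i)
    (d := dotp (delta_mx 0 i) (delta_mx 0 i))) => h.
  rewrite !(dotpDl, dotpDr, dotpZl, dotpZr) dotp_delta (dotpC _ x) dotp_delta.
  by ring.
by rewrite -/(enorm x); field; exact: enorm_neq0.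
Qed.

(** The left side is the squared length of the part of [x] orthogonal to [y]. This yields both
    [s^2 <= r^2] and its equality case. *)
Lemma sqr_dotp_defect x y : y != 0 ->
  dotp (x - (dotp x y / dotp y y) *: y) (x - (dotp x y / dotp y y) *: y) =
  enorm x ^+ 2 - (dotp x y / enorm y) ^+ 2.
Proof.
move=> y0; rewrite exprMn exprVn !sqr_enorm -scaleNr.
rewrite !(dotpDl, dotpDr, dotpZl, dotpZr) (dotpC y x); field.
by rewrite dotp_eq0.
Qed.

End Euclidean.

(** * Composites with [(r, s)] and their derivatives *)

Definition smooth2 (R : realType) (W : set (R * R)) (h : R -> R -> R) :=
  smooth_on W (fun p : R * R => h p.1 p.2).

(** A named composite is a head symbol that the differentiation tactic can match and that can be
    generalized to an atom before [field]. *)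
Definition profile (R : realType) (n : nat) (h : R -> R -> R)
  (x y : 'rV[R]_n) := h (enorm x) (dotp x y / enorm y).

Section ProfileDerivatives.
Variable R : realType.
Implicit Types (W : set (R * R)) (h : R -> R -> R).

Lemma derive1_fst (h : R -> R -> R) r s :
  (fun k : R => k^-1 *: (h (k *: (1 : R) + r) s - h r s)) =
  (fun k : R => k^-1 *: (h (k *: ((1, 0) : R * R) + (r, s)).1
    (k *: ((1, 0) : R * R) + (r, s)).2 - h r s)).
Proof. by apply/funext => k /=; rewrite [k *: 0]mulr0 add0r. Qed.

Lemma derive1_snd (h : R -> R -> R) r s :
  (fun k : R => k^-1 *: (h r (k *: (1 : R) + s) - h r s)) =
  (fun k : R => k^-1 *: (h (k *: ((0, 1) : R * R) + (r, s)).1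
    (k *: ((0, 1) : R * R) + (r, s)).2 - h r s)).
Proof. by apply/funext => k /=; rewrite [k *: 0]mulr0 add0r. Qed.

Lemma drE h : dr h = fun r s => 'D_((1, 0) : R * R) (fun p => h p.1 p.2) (r, s).
Proof.
apply/funext => r; apply/funext => s; rewrite /dr derive1E /derive /=.
by rewrite derive1_fst.
Qed.

Lemma dsE h : ds h = fun r s => 'D_((0, 1) : R * R) (fun p => h p.1 p.2) (r, s).
Proof.
apply/funext => r; apply/funext => s; rewrite /ds derive1E /derive /=.
by rewrite derive1_snd.
Qed.

Lemma smooth2_dr W h : smooth2 W h -> smooth2 W (dr h).
Proof.
move=> sh; rewrite /smooth2 drE.
under eq_fun do rewrite -surjective_pairing.
exact: smooth_derive.
Qed.

Lemma smooth2_ds W h : smooth2 W h -> smooth2 W (ds h).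
Proof.
move=> sh; rewrite /smooth2 dsE.
under eq_fun do rewrite -surjective_pairing.
exact: smooth_derive.
Qed.

Lemma is_derive_profilel n W h (x y : 'rV[R]_n) i : open W -> smooth2 W h ->
  x != 0 -> W (enorm x, dotp x y / enorm y) ->
  is_derive x (delta_mx 0 i) (fun z => profile h z y)
   (profile (dr h) x y * (x 0 i / enorm x) +
    profile (ds h) x y * (y 0 i / enorm y)).
Proof.
move=> oW sh x0 Wxy; rewrite /profile drE dsE.
apply: (is_derive_comp2 (h := fun p => h p.1 p.2) oW sh Wxy).
- exact: is_derive_enorm.
- apply: is_derive_to.
    by apply: is_derive_mul; exact: is_derive_dotpl.
  by rewrite mulr0 addr0.
Qed.

Lemma is_derive_profiler n W h (x y : 'rV[R]_n) i : open W -> smooth2 W h ->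
  y != 0 -> W (enorm x, dotp x y / enorm y) ->
  is_derive y (delta_mx 0 i) (fun z => profile h x z)
   (profile (ds h) x y *
     (x 0 i / enorm y - dotp x y / enorm y * y 0 i / enorm y ^+ 2)).
Proof.
move=> oW sh y0 Wxy; rewrite /profile dsE.
apply: is_derive_to.
  apply: (is_derive_comp2 (h := fun p => h p.1 p.2)
      (a := fun _ => enorm x) (b := fun z => dotp x z / enorm z) oW sh Wxy).
  apply: is_derive_mul; first exact: is_derive_dotpr.
  apply: is_derive_inv; first exact: enorm_neq0.
  exact: is_derive_enorm.
rewrite /= mulr0 add0r; congr (_ * _); field.
exact: enorm_neq0.
Qed.

End ProfileDerivatives.

(** * Fundamental tensor and spray *)

Section Contractions.
Variables (R : realType) (n : nat).
Implicit Types (x y : 'rV[R]_n).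

(** Serves the product of first derivatives in the Riemann curvature, where both factors have this
    shape in the summed index. *)
Lemma sum_delta_lin2 x y (i : 'I_n) (a p q a' p' q' : R) :
  \sum_(k < n) (a * (k == i)%:R + p * x 0 k + q * y 0 k) *
               (a' * (k == i)%:R + p' * x 0 k + q' * y 0 k) =
  a * a' + a * (p' * x 0 i + q' * y 0 i) + a' * (p * x 0 i + q * y 0 i) +
  p * p' * dotp x x + (p * q' + q * p') * dotp x y + q * q' * dotp y y.
Proof.
pose d (k : 'I_n) : R := (k == i)%:R.
have sum_d (f : 'I_n -> R) : \sum_(k < n) d k * f k = f i.
  rewrite (bigD1 i) //= big1 ?addr0 /d ?eqxx ?mul1r // => j /negbTE ->.
  by rewrite mul0r.
transitivity (\sum_(k < n) (d k * (a * a' * d k + a * (p' * x 0 k + q' * y 0 k)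
   + a' * (p * x 0 k + q * y 0 k)) + (p * p' * (x 0 k * x 0 k) +
   ((p * q' + q * p') * (x 0 k * y 0 k) + q * q' * (y 0 k * y 0 k))))).
  by apply: eq_bigr => k _; rewrite -/(d k); ring.
rewrite !big_split /= -!mulr_sumr sum_d /dotp /= {1}/d eqxx /=; ring.
Qed.

Lemma sum_delta_lin1 (v x y : 'rV[R]_n) (i : 'I_n) (a p q : R) :
  \sum_(k < n) v 0 k * (a * (k == i)%:R + p * x 0 k + q * y 0 k) =
  a * v 0 i + p * dotp x v + q * dotp y v.
Proof.
transitivity (\sum_(k < n) ((k == i)%:R * (a * v 0 k) +
    (p * (x 0 k * v 0 k) + q * (y 0 k * v 0 k)))).
  by apply: eq_bigr => k _; ring.
rewrite !big_split /= -!mulr_sumr (bigD1 i) //= big1 => [|j /negbTE ->].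
  by rewrite eqxx /dotp /=; ring.
by rewrite mul0r.
Qed.

(** The shape of second derivatives of the spray on the diagonal: [i == k] comes from
    differentiating the coordinate [i] in direction [k], and [k == i] from the converse. *)
Lemma sum_delta2_lin1 (v x y : 'rV[R]_n) (i : 'I_n) (a p q e : R) :
  \sum_(k < n) v 0 k * (a * (i == k)%:R + p * x 0 k + q * y 0 k +
     e * (k == i)%:R) = (a + e) * v 0 i + p * dotp x v + q * dotp y v.
Proof.
rewrite -sum_delta_lin1; apply: eq_bigr => k _; rewrite [i == k]eq_sym; ring.
Qed.

Lemma exists_orthogonal (y : 'rV[R]_n) : (1 < n)%N -> y != 0 ->
  exists2 v, v != 0 & dotp y v = 0.
Proof.
move=> n1 y0; have /rV0Pn[j yj] := y0.
have [i ij] : exists i : 'I_n, i != j.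
  pose i0 : 'I_n := Ordinal (ltnW n1); pose i1 : 'I_n := Ordinal n1.
  by case: (eqVneq i0 j) => [<-|]; [exists i1|exists i0].
(* A quarter turn of the coordinates [i] and [j] of [y]; its entry [i] is [y 0 j], which is
   nonzero. *)
exists (y 0 j *: delta_mx 0 i - y 0 i *: delta_mx 0 j).
  apply/rV0Pn; exists i.
  by rewrite !mxE !eqxx (negbTE ij) /= mulr1 mulr0 subr0.
by rewrite -scaleNr dotpDr !dotpZr !dotp_delta; ring.
Qed.

(** The part [c] independent of [i] is the only way the dimension enters the Ricci curvature. *)
Lemma sum_quadratic x y (E : 'I_n -> R) (c c1 c2 c3 : R) :
  (forall i, E i = c + c1 * (x 0 i * x 0 i) + c2 * (x 0 i * y 0 i) +
     c3 * (y 0 i * y 0 i)) ->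
  \sum_(i < n) E i = n%:R * c + c1 * dotp x x + c2 * dotp x y + c3 * dotp y y.
Proof.
move=> EE; under eq_bigr do rewrite EE.
by rewrite !big_split /= -!mulr_sumr sumr_const card_ord mulr_natl.
Qed.

(** A nonzero row [v] with [v *m A = 0] would give the quadratic form the value zero. *)
Lemma posdef_unitmx m (A : 'M[R]_m) :
  (forall v : 'rV[R]_m, v != 0 -> 0 < (v *m A *m v^T) 0 0) -> A \in unitmx.
Proof.
move=> posA; rewrite -row_free_unit -kermx_eq0; apply/eqP/row_matrixP => i.
rewrite row0; apply/eqP; apply: contraT => v0.
by have := posA _ v0; rewrite -row_mul mulmx_ker row0 mul0mx mxE ltxx.
Qed.

End Contractions.

Section SphericalForm.
Variables (R : realType) (n : nat) (Om : set 'rV[R]_n) (W : set (R * R)).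
Hypotheses (oOm : open Om) (Om0 : forall x, Om x -> x != 0) (oW : open W)
  (OmW : forall x y : 'rV[R]_n, Om x -> y != 0 ->
     W (enorm x, dotp x y / enorm y)).
Local Notation tfun := ('rV[R]_n -> 'rV[R]_n -> R).
Implicit Types (x y : 'rV[R]_n) (f g : tfun).

Lemma dx_eq_on f g i x y : (forall z, Om z -> f z y = g z y) -> Om x ->
  dx i f x y = dx i g x y.
Proof. by move=> fg Omx; exact: derive_eq_on fg. Qed.

Lemma dy_eq_on f g i x y : (forall z, z != 0 -> f x z = g x z) -> y != 0 ->
  dy i f x y = dy i g x y.
Proof.
move=> fg y0; apply: (@derive_eq_on _ _ [set z | z != 0]) => //.
exact: open_nonzero.
Qed.

Lemma dx_val f i x y (d : R) : is_derive x (delta_mx 0 i) (fun z => f z y) d ->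
  dx i f x y = d.
Proof. by move=> [_ <-]. Qed.

Lemma dy_val f i x y (d : R) : is_derive y (delta_mx 0 i) (fun z => f x z) d ->
  dy i f x y = d.
Proof. by move=> [_ <-]. Qed.

Ltac smooth2_tac :=
  repeat first [assumption | apply: smooth2_dr | apply: smooth2_ds].
(** Used after [is_derive_to], when the derivative is still an existential variable: the rules fill
    it with a raw expression, which is compared with the intended closed form afterwards.
    [notypeclasses refine] keeps instance search for [is_derive] from interfering. *)
Ltac differentiate :=
  cbv beta;
  lazymatch goal with
  | |- is_derive _ _ (fun _ => ?c) _ =>
      notypeclasses refine (is_derive_const _ _ _)
  | |- is_derive _ _ (fun z => fun_of_matrix z _ ?k) _ =>
      notypeclasses refine (is_derive_coord _ _ _)
  | |- is_derive _ _ (fun z => enorm z) _ =>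
      notypeclasses refine (is_derive_enorm _ _); assumption
  | |- is_derive _ _ (@enorm _ _) _ =>
      notypeclasses refine (is_derive_enorm _ _); assumption
  | |- is_derive _ _ (dotp ?x) _ =>
      notypeclasses refine (is_derive_dotpr _ _ _)
  | |- is_derive _ _ (fun z => dotp z ?y) _ =>
      notypeclasses refine (is_derive_dotpl _ _ _)
  | |- is_derive _ _ (fun z => dotp ?x z) _ =>
      notypeclasses refine (is_derive_dotpr _ _ _)
  | |- is_derive _ _ (fun z => profile ?h z ?y) _ =>
      notypeclasses refine (is_derive_profilel _ oW _ _ _);
      [smooth2_tac | assumption | apply: OmW; assumption]
  | |- is_derive _ _ (profile ?h ?x) _ =>
      notypeclasses refine (is_derive_profiler _ oW _ _ _);
      [smooth2_tac | assumption | apply: OmW; assumption]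
  | |- is_derive _ _ (fun z => profile ?h ?x z) _ =>
      notypeclasses refine (is_derive_profiler _ oW _ _ _);
      [smooth2_tac | assumption | apply: OmW; assumption]
  | |- is_derive _ _ (fun z => @?f z * @?g z) _ =>
      notypeclasses refine (is_derive_mul _ _); differentiate
  | |- is_derive _ _ (fun z => @?f z + @?g z) _ =>
      notypeclasses refine (is_derive_add _ _); differentiate
  | |- is_derive _ _ (fun z => - @?f z) _ =>
      notypeclasses refine (is_derive_opp _); differentiate
  | |- is_derive _ _ (fun z => @?f z ^+ ?k) _ =>
      notypeclasses refine (is_derive_expn _ _); differentiate
  | |- is_derive _ _ (fun z => (@?f z)^-1) _ =>
      notypeclasses refine (is_derive_inv _ _);
      [exact: enorm_neq0 | differentiate]
  | |- ?g => idtac g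
  end.

(* [field] compares atoms up to conversion, which is very slow on derivatives. *)
Ltac generalize_atoms :=
  repeat match goal with
  | |- context [profile ?h ?x ?y] => generalize (profile h x y)
  | |- context [enorm ?x] => generalize (enorm x)
  | |- context [dotp ?x ?y] => generalize (dotp x y)
  | |- context [fun_of_matrix ?x ?i ?k] =>
      let t := fresh in set t := fun_of_matrix x i k; clearbody t
  | |- context [nat_of_bool ?b] => generalize (nat_of_bool b)
  end.
Ltac atomic_field :=
  generalize_atoms; intros; field; repeat (apply/andP; split); assumption.

Section Tensor.
Variable phi : R -> R -> R.
Hypothesis smooth_phi : smooth2 W phi.

Let F2 : tfun := fun x y => (enorm y * profile phi x y) ^+ 2.

Let dxF2 k : tfun := fun x y =>
  2 * profile phi x y * (enorm y ^+ 2 * profile (dr phi) x y * x 0 k / enorm x +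
    enorm y * profile (ds phi) x y * y 0 k).

Let dyF2 k : tfun := fun x y =>
  2 * profile phi x y *
  ((profile phi x y - dotp x y / enorm y * profile (ds phi) x y) * y 0 k +
    enorm y * profile (ds phi) x y * x 0 k).

Lemma dx_F2 k x y : Om x -> y != 0 -> dx k F2 x y = dxF2 k x y.
Proof.
move=> Omx y0; have x0 := Om0 Omx; apply: dx_val; apply: is_derive_to.
  by rewrite /F2; differentiate.
by rewrite /dxF2; move: (enorm_neq0 x0) (enorm_neq0 y0) => /=; atomic_field.
Qed.

Lemma dy_F2 k x y : Om x -> y != 0 -> dy k F2 x y = dyF2 k x y.
Proof.
move=> Omx y0; have x0 := Om0 Omx; apply: dy_val; apply: is_derive_to.
  by rewrite /F2; differentiate.
by rewrite /dyF2; move: (enorm_neq0 x0) (enorm_neq0 y0) => /=; atomic_field.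
Qed.

(** Terms are collected by the index [k], the one that the spray contracts with [y], so that
    [sum_delta_lin1] applies. *)
Lemma dy_dxF2 k l x y : Om x -> y != 0 ->
  dy l (dxF2 k) x y =
  2 * (enorm y * profile phi x y * profile (ds phi) x y) * (k == l)%:R +
  (4 * profile phi x y * profile (dr phi) x y * y 0 l / enorm x +
   2 * enorm y ^+ 2 * (profile (ds phi) x y * profile (dr phi) x y +
      profile phi x y * profile (ds (dr phi)) x y) / enorm x *
     (x 0 l / enorm y - dotp x y / enorm y * y 0 l / enorm y ^+ 2)) * x 0 k +
  (2 * profile phi x y * profile (ds phi) x y * y 0 l / enorm y +
   2 * enorm y * (profile (ds phi) x y ^+ 2 +
      profile phi x y * profile (ds (ds phi)) x y) *
     (x 0 l / enorm y - dotp x y / enorm y * y 0 l / enorm y ^+ 2)) * y 0 k.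
Proof.
move=> Omx y0; have x0 := Om0 Omx; apply: dy_val; apply: is_derive_to.
  by rewrite /dxF2; differentiate.
by move: (enorm_neq0 x0) (enorm_neq0 y0) => /=; atomic_field.
Qed.

(** These are the coefficients usually written rho, rho_1 and rho_0 for (alpha, beta)-metrics, with
    [x] as the one-form: the metric is [rho delta_ij + rho_0 x_i x_j + (rho_1 / u) (x_i y_j + x_j
    y_i) - (s rho_1 / u^2) y_i y_j]. *)
Definition tensor0 : R -> R -> R := fun r s =>
  phi r s * (phi r s - s * ds phi r s).
Definition tensor1 : R -> R -> R := fun r s =>
  ds phi r s * (phi r s - s * ds phi r s) - s * phi r s * ds (ds phi) r s.
Definition tensor2 : R -> R -> R := fun r s =>
  ds phi r s ^+ 2 + phi r s * ds (ds phi) r s.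

Lemma profile_tensor0 x y : profile tensor0 x y = profile phi x y *
  (profile phi x y - dotp x y / enorm y * profile (ds phi) x y).
Proof. by []. Qed.

Lemma profile_tensor1 x y : profile tensor1 x y = profile (ds phi) x y *
  (profile phi x y - dotp x y / enorm y * profile (ds phi) x y) -
  dotp x y / enorm y * profile phi x y * profile (ds (ds phi)) x y.
Proof. by []. Qed.

Lemma profile_tensor2 x y : profile tensor2 x y =
  profile (ds phi) x y ^+ 2 + profile phi x y * profile (ds (ds phi)) x y.
Proof. by []. Qed.

Let profile_tensor := (profile_tensor0, profile_tensor1, profile_tensor2).

Lemma dy_dyF2 k l x y : Om x -> y != 0 ->
  dy l (dyF2 k) x y = 2 * (profile tensor0 x y * (k == l)%:R +
    (profile tensor2 x y * x 0 l + profile tensor1 x y / enorm y * y 0 l) * x 0 k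
    + (profile tensor1 x y / enorm y * x 0 l - dotp x y / enorm y *
       profile tensor1 x y / enorm y ^+ 2 * y 0 l) * y 0 k).
Proof.
move=> Omx y0; have x0 := Om0 Omx; apply: dy_val; apply: is_derive_to.
  by rewrite /dyF2; differentiate.
rewrite !profile_tensor.
by move: (enorm_neq0 x0) (enorm_neq0 y0) => /=; atomic_field.
Qed.

Variable F : tfun.
Hypothesis F_form : forall x y, Om x -> y != 0 ->
  F x y = enorm y * profile phi x y.

Lemma sqf_form x y : Om x -> y != 0 -> sqf F x y = F2 x y.
Proof. by move=> Omx y0; rewrite /sqf F_form. Qed.

Lemma dx_sqf k x y : Om x -> y != 0 -> dx k (sqf F) x y = dxF2 k x y.
Proof.
move=> Omx y0; rewrite -dx_F2 //.
by apply: dx_eq_on => // z Omz; exact: sqf_form.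
Qed.

Lemma dy_dx_sqf k l x y : Om x -> y != 0 ->
  dy l (dx k (sqf F)) x y = dy l (dxF2 k) x y.
Proof.
by move=> Omx y0; apply: dy_eq_on => // z z0; exact: dx_sqf.
Qed.

Lemma fundamental_tensorE x y k l : Om x -> y != 0 ->
  fundamental_tensor F x y k l = profile tensor0 x y * (k == l)%:R +
    (profile tensor2 x y * x 0 l + profile tensor1 x y / enorm y * y 0 l) * x 0 k
    + (profile tensor1 x y / enorm y * x 0 l - dotp x y / enorm y *
       profile tensor1 x y / enorm y ^+ 2 * y 0 l) * y 0 k.
Proof.
move=> Omx y0; rewrite mxE.
have -> : dy l (dy k (sqf F)) x y = dy l (dyF2 k) x y.
  apply: dy_eq_on => // z z0; rewrite -dy_F2 //.
  by apply: dy_eq_on => // w w0; exact: sqf_form.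
by rewrite dy_dyF2 // mulrA mulVf ?mul1r // pnatr_eq0.
Qed.

Lemma fundamental_tensor_quad x y v : Om x -> y != 0 ->
  (v *m fundamental_tensor F x y *m v^T) 0 0 =
  profile tensor0 x y * dotp v v + profile tensor2 x y * dotp x v ^+ 2 +
  2 * (profile tensor1 x y / enorm y * dotp x v * dotp y v) -
  dotp x y / enorm y * profile tensor1 x y / enorm y ^+ 2 * dotp y v ^+ 2.
Proof.
move=> Omx y0; rewrite mxE.
under eq_bigr => j _.
  rewrite !mxE; under eq_bigr do rewrite fundamental_tensorE //.
  rewrite sum_delta_lin1; over.
rewrite /=; set X := dotp x v; set Y := dotp y v.
transitivity (\sum_(j < n) (profile tensor0 x y * (v 0 j * v 0 j) +
  ((profile tensor2 x y * X + profile tensor1 x y / enorm y * Y) *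
     (x 0 j * v 0 j) +
   (profile tensor1 x y / enorm y * X - dotp x y / enorm y *
       profile tensor1 x y / enorm y ^+ 2 * Y) * (y 0 j * v 0 j)))).
  by apply: eq_bigr => j _; ring.
rewrite !big_split /= -!mulr_sumr -/(dotp v v) -/(dotp x v) -/(dotp y v).
by rewrite -/X -/Y; ring.
Qed.

Hypothesis n_gt1 : (1 < n)%N.
Hypothesis phi_gt0 : forall x y, Om x -> y != 0 -> 0 < profile phi x y.
Hypothesis posdef : forall x y (v : 'rV[R]_n), Om x -> y != 0 -> v != 0 ->
  0 < (v *m fundamental_tensor F x y *m v^T) 0 0.

(** The denominator of [Q]. For independent [x] and [y], [phi^3] times it is the determinant of the
    fundamental tensor on their span, in an orthonormal basis. *)
Definition delta_phi : R -> R -> R := fun r s =>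
  phi r s - s * ds phi r s + (r ^+ 2 - s ^+ 2) * ds (ds phi) r s.

Lemma profile_delta x y : profile delta_phi x y =
  profile phi x y - dotp x y / enorm y * profile (ds phi) x y +
  (enorm x ^+ 2 - (dotp x y / enorm y) ^+ 2) * profile (ds (ds phi)) x y.
Proof. by []. Qed.

Lemma profile_Q x y : profile (Qfun phi) x y = (2 * enorm x)^-1 *
  ((- profile (dr phi) x y + dotp x y / enorm y * profile (ds (dr phi)) x y +
    enorm x * profile (ds (ds phi)) x y) / profile delta_phi x y).
Proof. by []. Qed.

Lemma profile_P x y : profile (Defs.Pfun phi) x y = - (profile phi x y)^-1 *
  (dotp x y / enorm y * profile phi x y +
   (enorm x ^+ 2 - (dotp x y / enorm y) ^+ 2) * profile (ds phi) x y) *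
   profile (Qfun phi) x y + (2 * enorm x * profile phi x y)^-1 *
   (dotp x y / enorm y * profile (dr phi) x y + enorm x * profile (ds phi) x y).
Proof. by []. Qed.

(* If [x] and [y] are independent, the vector [v] of their span that annihilates
   the differential of [F] has square [phi * (r^2 - s^2) * delta_phi]; otherwise
   [r^2 = s^2] and any [v] orthogonal to [y] works. *)
Lemma delta_phi_neq0 x y : Om x -> y != 0 -> profile delta_phi x y != 0.
Proof.
move=> Omx y0; have := sqr_dotp_defect x y0.
set w := x - _ *: y => wE.
have x0 := Om0 Omx.
have u0 := enorm_neq0 y0.
have phi0 : profile phi x y != 0 by rewrite lt0r_neq0 ?phi_gt0.
have yyE : dotp y y = enorm y ^+ 2 by rewrite sqr_enorm.
have xxE : dotp x x = enorm x ^+ 2 by rewrite sqr_enorm.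
have [w0|w0] := eqVneq w 0.
  have [v v0 yv] := exists_orthogonal n_gt1 y0.
  have xE : x = (dotp x y / dotp y y) *: y.
    by apply/eqP; rewrite -subr_eq0 -/w w0.
  have xv : dotp x v = 0 by rewrite xE dotpZl yv mulr0.
  have := posdef Omx y0 v0; rewrite fundamental_tensor_quad // xv yv.
  apply: contraTneq; rewrite profile_delta -wE w0.
  rewrite dotp0l mul0r addr0 profile_tensor0 => ->.
  by rewrite mulr0 !mul0r expr0n /= !mulr0 !addr0 subr0 ltxx.
(* The differential of [F] in [y] takes the value [s phi + (r^2 - s^2) phi_s] on [x] and [u phi] on
   [y]; [b] is minus their quotient. *)
pose b : R := - (dotp x y / enorm y * profile phi x y +
  (enorm x ^+ 2 - (dotp x y / enorm y) ^+ 2) * profile (ds phi) x y) /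
  (enorm y * profile phi x y).
have v0 : x + b *: y != 0.
  (* [w] is orthogonal to [y], so the pairing does not see [b]. *)
  have : dotp (x + b *: y) w = dotp w w.
    rewrite wE /w -scaleNr !(dotpDl, dotpDr, dotpZl, dotpZr) (dotpC y x) yyE xxE.
    by move: u0; atomic_field.
  apply: contra_eq_neq => ->.
  by rewrite dotp0l eq_sym dotp_eq0.
have := posdef Omx y0 v0; rewrite fundamental_tensor_quad //.
apply: contraTneq => D0; rewrite -leNgt le_eqVlt; apply/orP; left; apply/eqP.
have -> : 0 = profile phi x y * (enorm x ^+ 2 - (dotp x y / enorm y) ^+ 2) *
  profile delta_phi x y by rewrite D0 mulr0.
rewrite !(dotpDl, dotpDr, dotpZl, dotpZr) (dotpC y x) yyE xxE /b.
by rewrite !profile_tensor profile_delta; move: u0 phi0; atomic_field.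
Qed.

Lemma fundamental_tensor_unit x y : Om x -> y != 0 ->
  fundamental_tensor F x y \in unitmx.
Proof.
by move=> Omx y0; apply: posdef_unitmx => v; exact: posdef.
Qed.

Lemma sprayE i x y : Om x -> y != 0 ->
  spray F i x y = enorm y * profile (Defs.Pfun phi) x y * y 0 i +
    enorm y ^+ 2 * profile (Qfun phi) x y * x 0 i.
Proof.
move=> Omx y0; have x0 := Om0 Omx.
have u0 := enorm_neq0 y0; have r0 := enorm_neq0 x0.
pose G : 'rV[R]_n := (enorm y * profile (Defs.Pfun phi) x y) *: y +
    (enorm y ^+ 2 * profile (Qfun phi) x y) *: x.
have GE k : G 0 k = enorm y * profile (Defs.Pfun phi) x y * y 0 k +
    enorm y ^+ 2 * profile (Qfun phi) x y * x 0 k by rewrite !mxE.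
rewrite -GE /spray; set g := fundamental_tensor F x y.
have phi0 : profile phi x y != 0 by rewrite lt0r_neq0 ?phi_gt0.
have D0 := delta_phi_neq0 Omx y0.
have gG l : \sum_(k < n) dy l (dx k (sqf F)) x y * y 0 k - dx l (sqf F) x y =
    4 * \sum_(k < n) G 0 k * g k l.
  under eq_bigr do rewrite dy_dx_sqf // dy_dxF2 // mulrC.
  rewrite dx_sqf // sum_delta_lin1.
  under [in RHS]eq_bigr do rewrite fundamental_tensorE //.
  rewrite sum_delta_lin1 /G !mxE.
  rewrite !(dotpDr, dotpZr) (dotpC y x) -!sqr_enorm /dxF2.
  (* [Q] remains an atom below and its definition enters only through this relation, linear in [Q];
     [P] is unfolded. *)
  have QE : 2 * enorm x * profile delta_phi x y * profile (Qfun phi) x y -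
      (- profile (dr phi) x y + dotp x y / enorm y * profile (ds (dr phi)) x y +
       enorm x * profile (ds (ds phi)) x y) = 0.
    by rewrite profile_Q; move: r0 u0 D0; atomic_field.
  apply/eqP; rewrite -subr_eq0; apply/eqP.
  (* The multiple of [QE] is found by matching the terms in [ds (dr phi)]. *)
  rewrite -[RHS](mulr0 (- 2 * enorm y ^+ 3 * profile phi x y / enorm x *
    (x 0 l / enorm y - dotp x y / enorm y * y 0 l / enorm y ^+ 2))) -QE.
  rewrite !profile_tensor profile_P profile_delta.
  (* Writing the inner product as [s u] with [s] free leaves independent atoms for [field]. *)
  move: (dotp x y / enorm y) (mulfVK u0 (dotp x y)) => s <-.
  by move: u0 r0 phi0; atomic_field.
have g_sym k l : g k l = g l k.
  by rewrite /g !fundamental_tensorE // [l == k]eq_sym; ring.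
have gGE l : \sum_(k < n) G 0 k * g k l = (g *m G^T) l 0.
  by rewrite [RHS]mxE; apply: eq_bigr => k _; rewrite g_sym mulrC [G^T k 0]mxE.
transitivity ((invmx g *m (g *m G^T)) i 0); last first.
  by rewrite mulKmx ?fundamental_tensor_unit // [LHS]mxE.
rewrite [RHS]mxE mulr_sumr; apply: eq_bigr => l _; rewrite gG gGE.
by move: (invmx g i l) ((g *m G^T) l 0) => a b; field.
Qed.
End Tensor.

(** * Ricci curvature *)

Section RicciOfSpray.
Variables (P Q : R -> R -> R) (F : tfun).
Hypotheses (smooth_P : smooth2 W P) (smooth_Q : smooth2 W Q).
Hypothesis spray_form : forall i x y, Om x -> y != 0 ->
  spray F i x y = enorm y * profile P x y * y 0 i +
    enorm y ^+ 2 * profile Q x y * x 0 i.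

Let G i : tfun := fun x y => enorm y * profile P x y * y 0 i +
    enorm y ^+ 2 * profile Q x y * x 0 i.

Let dxG k i : tfun := fun x y =>
  enorm y ^+ 2 * profile Q x y * (i == k)%:R +
  (enorm y * profile (dr P) x y / enorm x * y 0 i +
   enorm y ^+ 2 * profile (dr Q) x y / enorm x * x 0 i) * x 0 k +
  (profile (ds P) x y * y 0 i + enorm y * profile (ds Q) x y * x 0 i) * y 0 k.

Let dyG k i : tfun := fun x y =>
  enorm y * profile P x y * (i == k)%:R +
  (profile (ds P) x y * y 0 i + enorm y * profile (ds Q) x y * x 0 i) * x 0 k +
  ((profile P x y - dotp x y / enorm y * profile (ds P) x y) / enorm y * y 0 i +
   (2 * profile Q x y - dotp x y / enorm y * profile (ds Q) x y) * x 0 i) *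
  y 0 k.

Lemma dx_G k i x y : Om x -> y != 0 -> dx k (G i) x y = dxG k i x y.
Proof.
move=> Omx y0; have x0 := Om0 Omx; apply: dx_val; apply: is_derive_to.
  by rewrite /G; differentiate.
by rewrite /dxG; move: (enorm_neq0 x0) (enorm_neq0 y0) => /=; atomic_field.
Qed.

Lemma dy_G k i x y : Om x -> y != 0 -> dy k (G i) x y = dyG k i x y.
Proof.
move=> Omx y0; have x0 := Om0 Omx; apply: dy_val; apply: is_derive_to.
  by rewrite /G; differentiate.
by rewrite /dyG; move: (enorm_neq0 x0) (enorm_neq0 y0) => /=; atomic_field.
Qed.

(** The derivative of [s] with respect to [y^j]. *)
Let sigma j x y : R :=
  x 0 j / enorm y - dotp x y / enorm y * y 0 j / enorm y ^+ 2.

Lemma dy_dxG j k i x y : Om x -> y != 0 -> dy j (dxG k i) x y =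
  (enorm y * profile (ds Q) x y * x 0 j +
     (2 * profile Q x y - dotp x y / enorm y * profile (ds Q) x y) * y 0 j) *
    (i == k)%:R +
  ((profile (dr P) x y * y 0 j / enorm y +
      enorm y * profile (ds (dr P)) x y * sigma j x y) / enorm x * y 0 i +
   enorm y * profile (dr P) x y / enorm x * (i == j)%:R +
   (2 * profile (dr Q) x y * y 0 j +
     enorm y ^+ 2 * profile (ds (dr Q)) x y * sigma j x y) / enorm x * x 0 i) *
    x 0 k +
  (profile (ds (ds P)) x y * sigma j x y * y 0 i +
   profile (ds P) x y * (i == j)%:R +
   (profile (ds Q) x y * y 0 j / enorm y +
     enorm y * profile (ds (ds Q)) x y * sigma j x y) * x 0 i) * y 0 k +
  (profile (ds P) x y * y 0 i + enorm y * profile (ds Q) x y * x 0 i) *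
    (k == j)%:R.
Proof.
move=> Omx y0; have x0 := Om0 Omx; apply: dy_val; apply: is_derive_to.
  by rewrite /dxG; differentiate.
by rewrite /sigma; move: (enorm_neq0 x0) (enorm_neq0 y0) => /=; atomic_field.
Qed.

Lemma dy_dyG j k i x y : Om x -> y != 0 -> dy j (dyG k i) x y =
  (profile P x y * y 0 j / enorm y + enorm y * profile (ds P) x y * sigma j x y)
    * (i == k)%:R +
  (profile (ds (ds P)) x y * sigma j x y * y 0 i +
   profile (ds P) x y * (i == j)%:R +
   (profile (ds Q) x y * y 0 j / enorm y +
     enorm y * profile (ds (ds Q)) x y * sigma j x y) * x 0 i) * x 0 k +
  ((- (dotp x y / enorm y) * profile (ds (ds P)) x y * sigma j x y / enorm y -
    (profile P x y - dotp x y / enorm y * profile (ds P) x y) * y 0 j /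
      enorm y ^+ 3) * y 0 i +
   (profile P x y - dotp x y / enorm y * profile (ds P) x y) / enorm y *
     (i == j)%:R +
   (profile (ds Q) x y - dotp x y / enorm y * profile (ds (ds Q)) x y) *
     sigma j x y * x 0 i) * y 0 k +
  ((profile P x y - dotp x y / enorm y * profile (ds P) x y) / enorm y * y 0 i +
   (2 * profile Q x y - dotp x y / enorm y * profile (ds Q) x y) * x 0 i) *
    (k == j)%:R.
Proof.
move=> Omx y0; have x0 := Om0 Omx; apply: dy_val; apply: is_derive_to.
  by rewrite /dyG; differentiate.
by rewrite /sigma; move: (enorm_neq0 x0) (enorm_neq0 y0) => /=; atomic_field.
Qed.

Lemma dx_spray k i x y : Om x -> y != 0 -> dx k (spray F i) x y = dxG k i x y.
Proof.
move=> Omx y0; rewrite -dx_G //.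
by apply: dx_eq_on => // z Omz; exact: spray_form.
Qed.

Lemma dy_spray k i x y : Om x -> y != 0 -> dy k (spray F i) x y = dyG k i x y.
Proof.
move=> Omx y0; rewrite -dy_G //.
by apply: dy_eq_on => // z z0; exact: spray_form.
Qed.

Lemma riemann_diagE i x y : Om x -> y != 0 ->
  riemann F i i x y = 2 * dxG i i x y - \sum_(k < n) y 0 k * dy i (dxG k i) x y
   + 2 * \sum_(k < n) G k x y * dy i (dyG k i) x y
   - \sum_(k < n) dyG k i x y * dyG i k x y.
Proof.
move=> Omx y0; rewrite /riemann dx_spray //; congr (_ - _ + 2 * _ - _).
- apply: eq_bigr => k _; congr (_ * _).
  by apply: dy_eq_on => // z z0; exact: dx_spray.
- apply: eq_bigr => k _; rewrite spray_form //; congr (_ * _).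
  by apply: dy_eq_on => // z z0; exact: dy_spray.
- by apply: eq_bigr => k _; rewrite !dy_spray.
Qed.


(** * Traces of the four terms of the Riemann curvature *)

Section Trace.
Variables x y : 'rV[R]_n.
Hypotheses (Omx : Om x) (y0 : y != 0).
Local Notation u := (enorm y).
Local Notation r := (enorm x).
Local Notation s := (dotp x y / enorm y).
Local Notation p := (profile P x y).
Local Notation pr := (profile (dr P) x y).
Local Notation ps := (profile (ds P) x y).
Local Notation prs := (profile (ds (dr P)) x y).
Local Notation pss := (profile (ds (ds P)) x y).
Local Notation q := (profile Q x y).
Local Notation qr := (profile (dr Q) x y).
Local Notation qs := (profile (ds Q) x y).
Local Notation qrs := (profile (ds (dr Q)) x y).
Local Notation qss := (profile (ds (ds Q)) x y).
Local Notation quadratic_trace c c1 c2 c3 :=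
  (n%:R * c + c1 * dotp x x + c2 * dotp x y + c3 * dotp y y).

Lemma trace_dx : \sum_(i < n) dxG i i x y = quadratic_trace
  (u ^+ 2 * q) (u ^+ 2 * qr / r) (u * pr / r + u * qs) ps.
Proof. by apply: sum_quadratic => i; rewrite /dxG eqxx /=; ring. Qed.

Lemma trace_dy_dx :
  \sum_(i < n) \sum_(k < n) y 0 k * dy i (dxG k i) x y = quadratic_trace
  (u ^+ 2 * (s * pr / r + ps)) (s * u ^+ 2 * qrs / r + u ^+ 2 * qss)
  (2 * u * qs + s * u / r * (prs + 2 * qr - s * qrs) + u * pss +
    u * (qs - s * qss))
  (ps + 2 * q - s * qs + s / r * (pr - s * prs) - s * pss).
Proof.
apply: sum_quadratic => i.
under eq_bigr do rewrite dy_dxG //.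
rewrite sum_delta2_lin1 eqxx /sigma -!sqr_enorm.
have x0 := Om0 Omx.
move: s (mulfVK (enorm_neq0 y0) (dotp x y)) => t <-.
by move: (enorm_neq0 x0) (enorm_neq0 y0) => /=; atomic_field.
Qed.

(** [k1] and [k2] are the inner products of the spray vector with [x] and [y]; [a1 x_i + a2 y_i] is
    the sum of the coefficients of [i == k] and [k == i] in [dy_dyG] on the diagonal. *)
Let a1 := ps + 2 * q - s * qs.
Let a2 := 2 * (p - s * ps) / u.
Let k1 := u ^+ 2 * (s * p + q * r ^+ 2).
Let k2 := u ^+ 3 * (p + s * q).

Lemma trace_G_dy_dy :
  \sum_(i < n) \sum_(k < n) G k x y * dy i (dyG k i) x y = quadratic_trace
  (k1 * ps + k2 * (p - s * ps) / u)
  (a1 * u ^+ 2 * q + k1 * qss + k2 * (qs - s * qss) / u)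
  (a1 * u * p + a2 * u ^+ 2 * q + k1 * (pss + (qs - s * qss)) / u -
     k2 * s * (pss + (qs - s * qss)) / u ^+ 2)
  (a2 * u * p - k1 * s * pss / u ^+ 2 +
     k2 * (s ^+ 2 * pss - (p - s * ps)) / u ^+ 3).
Proof.
apply: sum_quadratic => i.
under eq_bigr do rewrite dy_dyG //.
pose v : 'rV[R]_n := (u * p) *: y + (u ^+ 2 * q) *: x.
have vE k : G k x y = v 0 k by rewrite !mxE.
under eq_bigr do rewrite vE.
rewrite sum_delta2_lin1 /v !mxE !(dotpDr, dotpZr) (dotpC y x).
rewrite eqxx /sigma /a1 /a2 /k1 /k2 -!sqr_enorm.
have x0 := Om0 Omx.
move: s (mulfVK (enorm_neq0 y0) (dotp x y)) => t <-.
by move: (enorm_neq0 x0) (enorm_neq0 y0) => /=; atomic_field.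
Qed.

(** In [dyG k i] the coefficient of [y_k] is [b1 y_i + b2 x_i]. *)
Let b1 := (p - s * ps) / u.
Let b2 := 2 * q - s * qs.

Lemma trace_dy_dy :
  \sum_(i < n) \sum_(k < n) dyG k i x y * dyG i k x y = quadratic_trace
  (u ^+ 2 * p ^+ 2)
  (2 * u ^+ 2 * p * qs + u ^+ 2 * qs ^+ 2 * r ^+ 2 +
     (u * qs * ps + b2 * u * qs) * (s * u) + b2 * ps * u ^+ 2)
  (2 * u * p * (b2 + ps) + (ps * u * qs + u * qs * b2) * r ^+ 2 +
     (ps ^+ 2 + 2 * u * qs * b1 + b2 ^+ 2) * (s * u) +
     (b1 * ps + b2 * b1) * u ^+ 2)
  (2 * u * p * b1 + ps * b2 * r ^+ 2 + (ps * b1 + b1 * b2) * (s * u) +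
     b1 ^+ 2 * u ^+ 2).
Proof.
apply: sum_quadratic => i.
transitivity (\sum_(k < n)
  (u * p * (k == i)%:R + (ps * y 0 i + u * qs * x 0 i) * x 0 k +
     (b1 * y 0 i + b2 * x 0 i) * y 0 k) *
  (u * p * (k == i)%:R + (u * qs * x 0 i + b2 * y 0 i) * x 0 k +
     (ps * x 0 i + b1 * y 0 i) * y 0 k)).
  by apply: eq_bigr => k _; rewrite /dyG [i == k]eq_sym -/b1 -/b2; ring.
rewrite sum_delta_lin2 /b1 /b2 -!sqr_enorm.
have x0 := Om0 Omx.
move: s (mulfVK (enorm_neq0 y0) (dotp x y)) => t <-.
by move: (enorm_neq0 x0) (enorm_neq0 y0) => /=; atomic_field.
Qed.

(** A property of the spray alone: [P] and [Q] are arbitrary smooth functions here, and [phi] has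
    disappeared. *)
Lemma ricci_spray : ricci F x y = u ^+ 2 *
  ((n%:R - 1) * (2 * q - s / r * pr - ps + 2 * (r ^+ 2 - s ^+ 2) * ps * q +
      p ^+ 2 + 2 * s * p * q) +
   (r ^+ 2 - s ^+ 2) * (2 / r * qr - qss - s / r * qrs +
      2 * (r ^+ 2 - s ^+ 2) * q * qss + 4 * q ^+ 2 -
      (r ^+ 2 - s ^+ 2) * qs ^+ 2 - 2 * s * q * qs)).
Proof.
rewrite /ricci; under eq_bigr do rewrite riemann_diagE //.
rewrite sumrB big_split /= sumrB -!mulr_sumr.
rewrite trace_dx trace_dy_dx trace_G_dy_dy trace_dy_dy.
rewrite /a1 /a2 /b1 /b2 /k1 /k2 -!sqr_enorm.
have x0 := Om0 Omx.
move: s (mulfVK (enorm_neq0 y0) (dotp x y)) => t <-.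
by move: (enorm_neq0 x0) (enorm_neq0 y0) (n%:R : R) => /=; atomic_field.
Qed.

End Trace.

End RicciOfSpray.
End SphericalForm.

(** * Smoothness on the slit tangent bundle *)

Section SlitBundle.
Variables (R : realType) (n : nat) (Omega : set 'rV[R]_n).
Hypothesis oOmega : open Omega.
Local Notation tfun := ('rV[R]_n -> 'rV[R]_n -> R).
Local Notation S := (slit_bundle Omega).
Implicit Types (x y : 'rV[R]_n) (f g : tfun).

Definition smooth_tfun f :=
  smooth_on S (fun p : 'rV[R]_n * 'rV[R]_n => f p.1 p.2).

Lemma open_slit_bundle : open S.
Proof.
rewrite openE => -[x y] [/= Ox y0].
exists (Omega, [set y | y != 0]) => //; split.
  exact: (open_nbhs_nbhs (conj oOmega Ox)).
exact: (open_nbhs_nbhs (conj (@open_nonzero _ _) y0)).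
Qed.

Let oS := open_slit_bundle.

Lemma dxE i f x y : dx i f x y =
  'D_((delta_mx 0 i, 0) : 'rV[R]_n * 'rV[R]_n) (fun p => f p.1 p.2) (x, y).
Proof.
rewrite /dx /derive.
have -> : (fun h : R => h^-1 *: (f (h *: delta_mx 0 i + x) y - f x y)) =
  (fun h => h^-1 *: (f
    (h *: ((delta_mx 0 i, 0) : 'rV[R]_n * 'rV[R]_n) + (x, y)).1
    (h *: ((delta_mx 0 i, 0) : 'rV[R]_n * 'rV[R]_n) + (x, y)).2 - f x y)).
  by apply/funext => h /=; rewrite scaler0 add0r.
by [].
Qed.

Lemma dyE i f x y : dy i f x y =
  'D_((0, delta_mx 0 i) : 'rV[R]_n * 'rV[R]_n) (fun p => f p.1 p.2) (x, y).
Proof.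
rewrite /dy /derive.
have -> : (fun h : R => h^-1 *: (f x (h *: delta_mx 0 i + y) - f x y)) =
  (fun h => h^-1 *: (f
    (h *: ((0, delta_mx 0 i) : 'rV[R]_n * 'rV[R]_n) + (x, y)).1
    (h *: ((0, delta_mx 0 i) : 'rV[R]_n * 'rV[R]_n) + (x, y)).2 - f x y)).
  by apply/funext => h /=; rewrite scaler0 add0r.
by [].
Qed.

Lemma smooth_tfun_is_dx i f x y : smooth_tfun f -> Omega x -> y != 0 ->
  is_derive x (delta_mx 0 i) (fun z => f z y) (dx i f x y).
Proof.
move=> sf Ox y0; apply/derivableP.
have Sxy : S (x, y) by [].
have := smooth_derivable (v := (delta_mx 0 i, 0)) sf Sxy.
rewrite /derivable.
have -> : (fun h : R => h^-1 *: (f (h *: delta_mx 0 i + x) y - f x y)) =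
  (fun h => h^-1 *: (f
    (h *: ((delta_mx 0 i, 0) : 'rV[R]_n * 'rV[R]_n) + (x, y)).1
    (h *: ((delta_mx 0 i, 0) : 'rV[R]_n * 'rV[R]_n) + (x, y)).2 - f x y)).
  by apply/funext => h /=; rewrite scaler0 add0r.
by [].
Qed.

Lemma smooth_tfun_dx i f : smooth_tfun f -> smooth_tfun (dx i f).
Proof.
move=> sf; rewrite /smooth_tfun;
under eq_fun do rewrite dxE -surjective_pairing.
exact: smooth_derive.
Qed.

Lemma smooth_tfun_dy i f : smooth_tfun f -> smooth_tfun (dy i f).
Proof.
move=> sf; rewrite /smooth_tfun;
under eq_fun do rewrite dyE -surjective_pairing.
exact: smooth_derive.
Qed.

Lemma smooth_tfun_coord k : smooth_tfun (fun _ y => y 0 k).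
Proof.
apply: smooth_linear => //.
  move=> p; apply: (@continuous_comp _ _ _ snd (fun y : 'rV[R]_n => y 0 k)).
    exact: cvg_snd.
  exact: coord_continuous.
by move=> h v x; rewrite /= !mxE.
Qed.

Lemma smooth_det m (A : 'rV[R]_n * 'rV[R]_n -> 'M[R]_m) :
  (forall i j, smooth_on S (fun p => A p i j)) ->
  smooth_on S (fun p => \det (A p)).
Proof.
move=> sA; apply: smooth_sum => // s; apply: smooth_mul => //.
  exact: smooth_cst.
by apply: smooth_prod => // i; exact: sA.
Qed.

(** By Cramer's rule the entries are cofactors divided by the determinant. *)
Lemma smooth_invmx m (A : 'rV[R]_n * 'rV[R]_n -> 'M[R]_m) i j :
  (forall i j, smooth_on S (fun p => A p i j)) ->
  (forall p, S p -> A p \in unitmx) ->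
  smooth_on S (fun p => invmx (A p) i j).
Proof.
move=> sA uA.
apply: (smooth_ext (f := fun p => (\det (A p))^-1 * cofactor (A p) j i)) => //.
  by move=> p Sp; rewrite /invmx uA // !mxE.
apply: smooth_mul => //.
  apply: smooth_inv => //; first exact: smooth_det.
  by move=> p /uA; rewrite unitmxE unitfE.
apply: smooth_mul => //; first exact: smooth_cst.
apply: smooth_det => k l; under eq_fun do rewrite !mxE.
exact: sA.
Qed.

Variable F : tfun.
Hypothesis finsler : is_finsler Omega F.

Lemma smooth_tfun_sqf : smooth_tfun (sqf F).
Proof.
have [_ sF _ _] := finsler.
exact: smooth_exp.
Qed.

Lemma finsler_tensor_unit x y : Omega x -> y != 0 ->
  fundamental_tensor F x y \in unitmx.
Proof.
by have [_ _ _ pos] := finsler => Ox y0; apply: posdef_unitmx => v; exact: pos.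
Qed.

Lemma smooth_tfun_spray i : smooth_tfun (spray F i).
Proof.
have s2 := smooth_tfun_sqf.
apply: smooth_mul => //; first exact: smooth_cst.
apply: smooth_sum => // l; apply: smooth_mul => //.
  apply: (smooth_invmx (A := fun p => fundamental_tensor F p.1 p.2)).
    move=> k j; under eq_fun do rewrite mxE.
    apply: smooth_mul => //; first exact: smooth_cst.
    exact/smooth_tfun_dy/smooth_tfun_dy.
  by move=> p [Op p0]; exact: finsler_tensor_unit.
apply: smooth_sub_fun => //; last exact: smooth_tfun_dx.
apply: smooth_sum => // k; apply: smooth_mul => //.
  exact/smooth_tfun_dy/smooth_tfun_dx.
exact: smooth_tfun_coord.
Qed.

(** Obtained from the definition rather than from the closed formula, so that it also covers
    [x = 0], where continuity is needed. *)
Lemma smooth_tfun_ricci : smooth_tfun (ricci F).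
Proof.
have sG := smooth_tfun_spray.
have sum_mul (f g : 'I_n -> tfun) : (forall k, smooth_tfun (f k)) ->
    (forall k, smooth_tfun (g k)) ->
    smooth_tfun (fun x y => \sum_(k < n) f k x y * g k x y).
  by move=> sf sg; apply: smooth_sum => // k;
    exact: (smooth_mul oS (sf k) (sg k)).
apply: smooth_sum => // i; apply: smooth_sub_fun => //; last first.
  by apply: (sum_mul (fun k => dy k (spray F i)) (fun k => dy i (spray F k))) => k;
    exact: smooth_tfun_dy.
apply: smooth_add => //; last first.
  apply: smooth_mul => //; first exact: smooth_cst.
  apply: (sum_mul (spray F) (fun k => dy i (dy k (spray F i)))) => // k.
  exact/smooth_tfun_dy/smooth_tfun_dy.
apply: smooth_sub_fun => //.
  apply: smooth_mul => //; first exact: smooth_cst.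
  exact: smooth_tfun_dx.
apply: (sum_mul (fun k _ y => y 0 k) (fun k => dy i (dx k (spray F i)))) => k.
  exact: smooth_tfun_coord.
exact/smooth_tfun_dy/smooth_tfun_dx.
Qed.

Lemma smooth_tfun_line f x y (v : 'rV[R]_n) : smooth_tfun f -> Omega x ->
  y != 0 -> f (h *: v + x) y @[h --> (0 : R)^'] --> f x y.
Proof.
move=> sf Ox y0.
have Sxy : S (x, y) by [].
have := smooth_derivable (v := (v, 0)) sf Sxy.
move=> /derivable1P/derivable1_diffP/differentiable_continuous.
move=> /continuous_withinNx; rewrite !scale0r !add0r /=.
by under eq_fun do rewrite scaler0 add0r.
Qed.

End SlitBundle.

(** * Dimension one *)

(* In dimension one, [F ^ 2 = q(x) y ^ 2] on each side of the zero section, so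
   the spray is [m(x) y ^ 2], whose Riemann curvature vanishes. *)
Lemma ricci_dim1 (R : realType) (Omega : set 'rV[R]_1)
    (F : 'rV[R]_1 -> 'rV[R]_1 -> R) (x0 y : 'rV[R]_1) :
  open Omega -> is_finsler Omega F -> Omega x0 -> y != 0 -> ricci F x0 y = 0.
Proof.
move=> oO fF Ox0 y0; have [_ _ hom _] := fF.
have s2 := smooth_tfun_sqf oO fF; have s2x := smooth_tfun_dx ord0 s2.
pose t := y 0 0.
have t0 : t != 0.
  have /rV0Pn[i] := y0; by rewrite (ord1 i).
(* The open half-line containing [y]. Homogeneity is only positive, so [F] at [y] does not control
   the other half. *)
pose S : set 'rV[R]_1 := [set z | 0 < z 0 0 * t].
have oS : open S.
  apply: (@open_comp _ _ (fun z : 'rV[R]_1 => z 0 0 * t) [set a | 0 < a]).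
    move=> z _.
    have cz : {for z, continuous (fun w : 'rV[R]_1 => w 0 0)}.
      exact: coord_continuous.
    exact: (cvgM cz (cvg_cst t)).
  exact: open_gt.
have t2_gt0 : 0 < t ^+ 2 by rewrite lt_neqAle eq_sym sqrf_eq0 t0 sqr_ge0.
have Sy : S y by rewrite /S /= -/t -expr2.
pose q z := sqf F z y / t ^+ 2; pose q1 z := dx ord0 (sqf F) z y / t ^+ 2.
pose q2 z := dx ord0 (dx ord0 (sqf F)) z y / t ^+ 2.
have dq z : Omega z -> is_derive z (delta_mx 0 ord0) q (q1 z).
  move=> Oz; apply: is_derive_to.
    by apply: is_derive_mul; exact: smooth_tfun_is_dx.
  by rewrite /q1 mulr0 addr0.
have dq1 z : Omega z -> is_derive z (delta_mx 0 ord0) q1 (q2 z).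
  move=> Oz; apply: is_derive_to.
    by apply: is_derive_mul; exact: smooth_tfun_is_dx.
  by rewrite /q2 mulr0 addr0.
have sqfE z x : Omega x -> S z -> sqf F x z = z 0 0 ^+ 2 * q x.
  move=> Ox Sz; have -> : z = (z 0 0 / t) *: y.
    by apply/rowP => i; rewrite !mxE (ord1 i) -/t mulfVK.
  have c0 : 0 < z 0 0 / t.
    by rewrite -(pmulr_lgt0 _ t2_gt0) expr2 mulrA mulfVK.
  by rewrite /q /sqf hom // !mxE -/t mulfVK //; field.
have dyS (f g : 'rV[R]_1 -> 'rV[R]_1 -> R) x z :
    (forall w, S w -> f x w = g x w) -> S z -> dy ord0 f x z = dy ord0 g x z.
  by move=> fg Sz; exact: (derive_eq_on (delta_mx 0 ord0) oS Sz fg).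
have dxO (f g : 'rV[R]_1 -> 'rV[R]_1 -> R) x z :
    (forall w, Omega w -> f w z = g w z) -> Omega x ->
    dx ord0 f x z = dx ord0 g x z.
  by move=> fg Ox; exact: (derive_eq_on (delta_mx 0 ord0) oO Ox
    (f := f^~ z) (g := g^~ z) fg).
have dxM (m : 'rV[R]_1 -> R) (m1 : R) x z :
    is_derive x (delta_mx 0 ord0) m m1 ->
    dx ord0 (fun x z => z 0 0 ^+ 2 * m x) x z = z 0 0 ^+ 2 * m1.
  move=> dm; rewrite -[RHS]add0r -(mul0r (m x)).
  exact: (dx_val (is_derive_mul (is_derive_const (z 0 0 ^+ 2) _ _) dm)).
have dy2 (m : 'rV[R]_1 -> R) x z :
    dy ord0 (fun x z => z 0 0 ^+ 2 * m x) x z = 2 * z 0 0 * m x.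
  apply: dy_val; apply: is_derive_to.
    exact: (is_derive_mul (is_derive_expn 2 (is_derive_coord _ _ 0))
      (is_derive_const (m x) _ _)).
  by rewrite eqxx /=; ring.
have dy1 (m : 'rV[R]_1 -> R) x z :
    dy ord0 (fun x z => 2 * z 0 0 * m x) x z = 2 * m x.
  apply: dy_val; apply: is_derive_to.
    exact: (is_derive_mul (is_derive_mul (is_derive_const 2 _ _)
      (is_derive_coord _ _ 0)) (is_derive_const (m x) _ _)).
  by rewrite eqxx /=; ring.
have tensorE x z : Omega x -> S z -> fundamental_tensor F x z 0 0 = q x.
  move=> Ox Sz; rewrite mxE.
  have -> : dy ord0 (dy ord0 (sqf F)) x z = 2 * q x.
    rewrite -(dy1 q x z); apply: (dyS) => // w Sw; rewrite -dy2.
    by apply: (dyS _ _ _ _ _ Sw) => w' Sw'; exact: sqfE.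
  by rewrite mulrA mulVf ?mul1r // pnatr_eq0.
have S0 z : S z -> z != 0.
  by apply: contraTneq => ->; rewrite /S /= mxE mul0r ltxx.
have unit_tensor x z : Omega x -> S z ->
    invmx (fundamental_tensor F x z) 0 0 * q x = 1.
  move=> Ox Sz; rewrite -(tensorE _ z) //.
  have := mulVmx (finsler_tensor_unit fF Ox (S0 _ Sz)).
  by move=> /matrixP/(_ 0 0); rewrite mxE big_ord1 !mxE eqxx.
have q0 x : Omega x -> q x != 0.
  move=> Ox; apply: contra_eq_neq (unit_tensor _ _ Ox Sy) => ->.
  by rewrite mulr0 eq_sym oner_eq0.
(* With [g = q] the spray is [(4 q)^-1 (2 q1 z * z - q1 z^2) = m z^2]. *)
pose m x := q1 x / (4 * q x).
pose m1 x := (q2 x * q x - q1 x ^+ 2) / (4 * q x ^+ 2).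
have dm x : Omega x -> is_derive x (delta_mx 0 ord0) m (m1 x).
  move=> Ox; have qx0 := q0 _ Ox; apply: is_derive_to.
    apply: is_derive_mul; first exact: dq1.
    apply: is_derive_inv; first by rewrite mulf_neq0 // pnatr_eq0.
    exact: (is_derive_mul (is_derive_const 4 _ _) (dq _ Ox)).
  by rewrite /m1; move: (q1 x) (q2 x) (q x) qx0 => a b c c0; field.
have sprayE z x : Omega x -> S z -> spray F ord0 x z = z 0 0 ^+ 2 * m x.
  move=> Ox Sz; rewrite /spray !big_ord1.
  have dxE w : S w -> dx ord0 (sqf F) x w = w 0 0 ^+ 2 * q1 x.
    move=> Sw; rewrite -(dxM q (q1 x) x w (dq _ Ox)).
    by apply: (dxO _ _ _ _ _ Ox) => x' Ox'; exact: sqfE.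
  have -> : dy ord0 (dx ord0 (sqf F)) x z = 2 * z 0 0 * q1 x.
    by rewrite -dy2; apply: (dyS).
  rewrite dxE //; have qx0 := q0 _ Ox; move: (unit_tensor x z Ox Sz).
  rewrite /m; move: (invmx _ 0 0) (q1 x) (q x) qx0 (z 0 0) => g a b b0 c gb.
  have -> : g = b^-1 by apply: (mulIf b0); rewrite gb mulVf.
  by field.
have sum1 (f : 'I_1 -> R) : \sum_(k < 1) f k = f ord0 by exact: big_ord1.
have ->: ricci F x0 y = 2 * dx ord0 (spray F ord0) x0 y -
    y 0 0 * dy ord0 (dx ord0 (spray F ord0)) x0 y +
    2 * (spray F ord0 x0 y * dy ord0 (dy ord0 (spray F ord0)) x0 y) -
    dy ord0 (spray F ord0) x0 y * dy ord0 (spray F ord0) x0 y.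
  rewrite /ricci sum1 /riemann; congr (_ - _ + 2 * _ - _).
  - exact: (sum1 (fun k => y 0 k * dy ord0 (dx k (spray F ord0)) x0 y)).
  - exact: (sum1 (fun k =>
      spray F k x0 y * dy ord0 (dy k (spray F ord0)) x0 y)).
  - exact: (sum1 (fun k =>
      dy k (spray F ord0) x0 y * dy ord0 (spray F k) x0 y)).
have dxGE w : S w -> dx ord0 (spray F ord0) x0 w = w 0 0 ^+ 2 * m1 x0.
  move=> Sw; rewrite -(dxM m (m1 x0) x0 w (dm _ Ox0)).
  by apply: (dxO _ _ _ _ _ Ox0) => x' Ox'; exact: sprayE.
have dyGE w : S w -> dy ord0 (spray F ord0) x0 w = 2 * w 0 0 * m x0.
  by move=> Sw; rewrite -dy2; apply: (dyS _ _ _ _ _ Sw) => w' Sw'; exact: sprayE.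
have dydxGE : dy ord0 (dx ord0 (spray F ord0)) x0 y = 2 * y 0 0 * m1 x0.
  by rewrite -dy2; apply: (dyS).
have dydyGE : dy ord0 (dy ord0 (spray F ord0)) x0 y = 2 * m x0.
  by rewrite -(dy1 _ _ y); apply: (dyS).
(* With [t = y 0 0] the four terms are [2 m1 t^2], [- 2 m1 t^2], [4 m^2 t^2] and [- 4 m^2 t^2]. *)
have cancel (a b c d e : R) : a = y 0 0 ^+ 2 * m1 x0 ->
    b = 2 * y 0 0 * m1 x0 -> c = y 0 0 ^+ 2 * m x0 -> d = 2 * m x0 ->
    e = 2 * y 0 0 * m x0 -> 2 * a - y 0 0 * b + 2 * (c * d) - e * e = 0.
  move=> -> -> -> -> ->; move: (y 0 0) (m x0) (m1 x0) => *; ring.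
exact: (cancel _ _ _ _ _
  (dxGE _ Sy) dydxGE (sprayE _ _ Ox0 Sy) dydyGE (dyGE _ Sy)).
Qed.

(** * Einstein condition *)

Lemma smooth_fst (R : realType) (W : set (R * R)) : open W ->
  smooth_on W (fun p : R * R => p.1).
Proof.
move=> oW; apply: smooth_linear => // p.
exact: cvg_fst.
Qed.

Lemma smooth_snd (R : realType) (W : set (R * R)) : open W ->
  smooth_on W (fun p : R * R => p.2).
Proof.
move=> oW; apply: smooth_linear => // p.
exact: cvg_snd.
Qed.

(** * Smoothness of [P] and [Q] *)

Section SprayCoefficients.
Variables (R : realType) (W : set (R * R)) (phi : R -> R -> R).
Hypotheses (oW : open W) (smooth_phi : smooth2 W phi).
Ltac smooth_tac :=
  cbv beta;
  lazymatch goal with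
  | |- smooth_on _ (fun _ => ?c) => exact: (smooth_cst _ oW)
  | |- smooth_on _ (fun p => p.1) => exact: (smooth_fst oW)
  | |- smooth_on _ (fun p => p.2) => exact: (smooth_snd oW)
  | |- smooth_on _ (@fst _ _) => exact: (smooth_fst oW)
  | |- smooth_on _ (@snd _ _) => exact: (smooth_snd oW)
  | |- smooth_on _ (fun p => _ * _) => apply: (smooth_mul oW); smooth_tac
  | |- smooth_on _ (fun p => _ + _) => apply: (smooth_add oW); smooth_tac
  | |- smooth_on _ (fun p => - _) => apply: (smooth_opp oW); smooth_tac
  | |- smooth_on _ (fun p => _^-1) => apply: (smooth_inv oW); [smooth_tac|]
  | |- smooth_on _ (fun p => _ ^+ _) => apply: (smooth_exp _ oW); smooth_tac
  | |- smooth_on _ (fun p => dr ?h _ _) =>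
      apply: (@smooth2_dr _ _ h); smooth_tac
  | |- smooth_on _ (fun p => ds ?h _ _) =>
      apply: (@smooth2_ds _ _ h); smooth_tac
  | |- smooth2 _ (dr ?h) => apply: (@smooth2_dr _ _ h); smooth_tac
  | |- smooth2 _ (ds ?h) => apply: (@smooth2_ds _ _ h); smooth_tac
  | _ => exact: smooth_phi
  end.

Lemma smooth2_delta : smooth2 W (delta_phi phi).
Proof. by rewrite /smooth2 /delta_phi; smooth_tac. Qed.

Hypothesis W_neq0 : forall p, W p ->
  [/\ p.1 != 0, phi p.1 p.2 != 0 & delta_phi phi p.1 p.2 != 0].


Lemma smooth2_Q : smooth2 W (Qfun phi).
Proof.
rewrite /smooth2 /Qfun; smooth_tac.
  by move=> p /W_neq0 [p0 _ _]; rewrite mulf_neq0 // pnatr_eq0.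
by move=> p /W_neq0 [].
Qed.

Lemma smooth2_P : smooth2 W (Defs.Pfun phi).
Proof.
rewrite /smooth2 /Defs.Pfun.
apply: (smooth_add oW).
  apply: (smooth_mul oW); last exact: smooth2_Q.
  smooth_tac.
  by move=> p /W_neq0 [].
smooth_tac.
by move=> p /W_neq0 [p0 phi0 _]; rewrite !mulf_neq0 // pnatr_eq0.
Qed.

End SprayCoefficients.

Section RicciSpherical.
Variables (R : realType) (n : nat) (Omega : set 'rV[R]_n)
  (F : 'rV[R]_n -> 'rV[R]_n -> R) (phi : R -> R -> R).
Hypotheses (n_gt1 : (1 < n)%N) (oOmega : open Omega).
Hypotheses (finsler : is_finsler Omega F) (form : spherical_form Omega F phi).

(** The section on spherical forms is used twice: over [U], where [phi] is smooth, for the spray and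
    the nonvanishing of [delta_phi]; then over the part [W] of [U] where all denominators are
    nonzero, so that [P] and [Q] are smooth. The first use shows that [W] still contains every
    [(r, s)] that occurs. *)
Lemma ricci_spherical x y : Omega x -> x != 0 -> y != 0 ->
  ricci F x y = enorm y ^+ 2 *
    ((n%:R - 1) * R1fun phi (enorm x) (dotp x y / enorm y) +
     (enorm x ^+ 2 - (dotp x y / enorm y) ^+ 2) *
       R3fun phi (enorm x) (dotp x y / enorm y)).
Proof.
move=> Ox x0 y0.
have [phi_pos [U [oU rsU smooth_phi]] F_eq] := form.
have [_ _ _ posdef] := finsler.
pose Om : set 'rV[R]_n := Omega `&` [set z | z != 0].
have oOm : open Om by apply: openI => //; exact: open_nonzero.
have Om0 z : Om z -> z != 0 by case.
have OmU z w : Om z -> w != 0 -> U (enorm z, dotp z w / enorm w).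
  by move=> [Oz z0] w0; apply: rsU; exists z, w.
have F_form z w : Om z -> w != 0 -> F z w = enorm w * profile phi z w.
  by move=> [Oz _] _; exact: F_eq.
have phi_gt0 z w : Om z -> w != 0 -> 0 < profile phi z w.
  by move=> [Oz _]; exact: phi_pos.
have pos z w (v : 'rV[R]_n) : Om z -> w != 0 -> v != 0 ->
    0 < (v *m fundamental_tensor F z w *m v^T) 0 0.
  by move=> [Oz _]; exact: posdef.
have delta0 := delta_phi_neq0 Om0 oU OmU smooth_phi F_form n_gt1 phi_gt0 pos.
have spray_form := sprayE oOm Om0 oU OmU smooth_phi F_form n_gt1 phi_gt0 pos.
pose W1 := U `&` [set p : R * R | p.1 != 0].
pose W2 := W1 `&` [set p : R * R | phi p.1 p.2 != 0].
pose W := W2 `&` [set p : R * R | delta_phi phi p.1 p.2 != 0].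
have oW1 : open W1 by apply: open_neq0 => //; exact: smooth_fst.
have oW2 : open W2.
  by apply: open_neq0 => //; apply: smooth_sub smooth_phi => p [].
have oW : open W.
  apply: open_neq0 => //; apply: smooth2_delta => //.
  by apply: smooth_sub smooth_phi => p [[]].
have OmW z w : Om z -> w != 0 -> W (enorm z, dotp z w / enorm w).
  move=> Oz w0; split; last exact: delta0.
  split; last by rewrite /= lt0r_neq0 // phi_gt0.
  by split; [exact: OmU|exact/enorm_neq0/Om0].
have smooth_phiW : smooth2 W phi by apply: smooth_sub smooth_phi => p [[[]]].
have W_neq0 p : W p ->
    [/\ p.1 != 0, phi p.1 p.2 != 0 & delta_phi phi p.1 p.2 != 0].
  by move=> [[[]]].
exact: (ricci_spray oOm Om0 oW OmW (smooth2_P oW smooth_phiW W_neq0)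
  (smooth2_Q oW smooth_phiW W_neq0) spray_form).
Qed.

End RicciSpherical.

(** Allows a pair [(r, s)] realised at one point to be realised at any other point of the same
    norm. *)
Lemma exists_angle (R : realType) (n : nat) (x : 'rV[R]_n) (s : R) :
  (1 < n)%N -> x != 0 -> s ^+ 2 <= enorm x ^+ 2 ->
  exists2 y, y != 0 & dotp x y / enorm y = s.
Proof.
move=> n1 x0 sx; have [w w0 xw] := exists_orthogonal n1 x0.
have r0 := enorm_gt0 x0; have w_gt0 := enorm_gt0 w0.
(* Chosen so that [|y|^2 = s^2 r^2 + c^2 |w|^2 = r^4]; then [<x, y> / |y| = s r^2 / r^2]. *)
pose c := Num.sqrt (enorm x ^+ 2 - s ^+ 2) * enorm x / enorm w.
pose y := s *: x + c *: w.
have xy : dotp x y = s * enorm x ^+ 2.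
  by rewrite /y dotpDr !dotpZr xw mulr0 addr0 sqr_enorm.
have yy : dotp y y = (enorm x ^+ 2) ^+ 2.
  have c2 : c ^+ 2 * enorm w ^+ 2 = (enorm x ^+ 2 - s ^+ 2) * enorm x ^+ 2.
    rewrite /c !exprMn sqr_sqrtr ?subr_ge0 // exprVn mulfVK //.
    by rewrite expf_neq0 // lt0r_neq0.
  have -> : dotp y y = s ^+ 2 * enorm x ^+ 2 + c ^+ 2 * enorm w ^+ 2.
    rewrite /y !(dotpDl, dotpDr, dotpZl, dotpZr) (dotpC w x) xw !sqr_enorm.
    by ring.
  by rewrite c2; ring.
have yE : enorm y = enorm x ^+ 2.
  by rewrite /enorm yy sqrtr_sqr ger0_norm // sqr_ge0.
exists y; last by rewrite xy yE mulfK // expf_neq0 // lt0r_neq0.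
by rewrite -dotp_eq0 yy !expf_neq0 // lt0r_neq0.
Qed.

Lemma rs_range_le (R : realType) (n : nat) (Omega : set 'rV[R]_n) (r s : R) :
  rs_range Omega (r, s) -> s ^+ 2 <= r ^+ 2.
Proof.
move=> [x [y [_ _ y0 [-> ->]]]].
by rewrite -subr_ge0 -sqr_dotp_defect // dotp_ge0.
Qed.

Lemma cauchy_schwarz_dim1 (R : realType) (x y : 'rV[R]_1) : y != 0 ->
  enorm x ^+ 2 - (dotp x y / enorm y) ^+ 2 = 0.
Proof.
move=> y0; rewrite exprMn exprVn !sqr_enorm.
have : dotp y y != 0 by rewrite dotp_eq0.
rewrite /dotp !big_ord1 => yy0; field.
by move: yy0; rewrite mulf_eq0 negb_or => /andP[].
Qed.

(* The origin is reached by continuity: along a line through it, the ratio of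
   [ricci F x y] to [F x y ^ 2] does not depend on [y] off the origin. *)
Lemma ricci_ratio_origin (R : realType) (n : nat) (Omega : set 'rV[R]_n)
    (F : 'rV[R]_n -> 'rV[R]_n -> R) (y z : 'rV[R]_n) :
  open Omega -> is_finsler Omega F -> Omega 0 -> y != 0 -> z != 0 ->
  (forall x, Omega x -> x != 0 ->
     ricci F x y * F x z ^+ 2 = ricci F x z * F x y ^+ 2) ->
  ricci F 0 y * F 0 z ^+ 2 = ricci F 0 z * F 0 y ^+ 2.
Proof.
move=> oO fF O0 y0 z0 ratio.
have sR := smooth_tfun_ricci oO fF; have sF := smooth_tfun_sqf oO fF.
(* The origin is approached in the direction [y], which serves here as a nonzero vector of the
   base. *)
have lim w w' : w != 0 -> w' != 0 ->
    ricci F (h *: y + 0) w * sqf F (h *: y + 0) w' @[h --> (0 : R)^'] -->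
    ricci F 0 w * sqf F 0 w'.
  move=> w0 w'0; apply: cvgM.
    exact: (smooth_tfun_line y sR O0 w0).
  exact: (smooth_tfun_line y sF O0 w'0).
apply/eqP; rewrite -subr_eq0; apply/eqP.
have lim0 := @cvgB _ _ _ _ (dnbhs_filter _) _ _ _ _
  (lim _ _ y0 z0) (lim _ _ z0 y0).
rewrite -(cvg_lim (@norm_hausdorff _ R) lim0).
apply: lim_near_cst; first exact: norm_hausdorff.
near=> h.
have h0 : h != 0 by near: h; exact: nbhs_dnbhs_neq.
have hy : h *: y != 0 by rewrite scaler_eq0 negb_or h0.
have Oh : Omega (h *: y).
  near: h.
  have c0 : h *: y @[h --> (0 : R)] --> (0 : 'rV[R]_n).
    rewrite -[X in _ --> X](scale0r y).
    exact: scalel_continuous.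
  have O_nbhs : nbhs (0 : 'rV[R]_n) Omega by exact: open_nbhs_nbhs.
  exact: nbhs_dnbhs (c0 _ O_nbhs).
have ratio_h := ratio _ Oh hy; rewrite -[h *: y]addr0 in ratio_h.
have sub_eq0 (a b : R) : a = b -> a - b = 0 by move=> ->; rewrite subrr.
exact: (sub_eq0 (ricci F (h *: y + 0) y * F (h *: y + 0) z ^+ 2)
  (ricci F (h *: y + 0) z * F (h *: y + 0) y ^+ 2) ratio_h).
Unshelve. all: by end_near. Qed.

Theorem proposition5p2 (R : realType) (n : nat) (Omega : set 'rV[R]_n)
    (F : 'rV[R]_n -> 'rV[R]_n -> R) (phi : R -> R -> R)
    (hOmega : is_domain Omega)
    (hF : is_finsler Omega F)
    (hsym : spherically_symmetric Omega F)
    (hphi : spherical_form Omega F phi) :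
  is_einstein Omega F <->
  exists K : R -> R, forall r s : R, rs_range Omega (r, s) ->
    (n%:R - 1) * R1fun phi r s + (r ^+ 2 - s ^+ 2) * R3fun phi r s
    = (n%:R - 1) * K r * phi r s ^+ 2.
Proof.
have [oO _ _] := hOmega; have [phi_gt0 _ F_eq] := hphi.
have [n_gt1|n_le1] := ltnP 1 n; last first.
  case: n n_le1 Omega F hOmega hF hsym hphi oO phi_gt0 F_eq => [|[|//]] _.
    (* Dimension zero: without a nonzero [y] both conditions are vacuous. *)
    move=> Omega F *; split=> _; exists (fun _ => 0).
      by move=> r s [x [y [_ /rV0Pn [[]]]]].
    by move=> x y _ /rV0Pn [[]].
  move=> Omega F _ fF _ _ oO _ _; split=> _; exists (fun _ => 0).
    move=> r s [x [y [_ _ y0 [-> ->]]]].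
    by rewrite cauchy_schwarz_dim1 // subrr !mul0r addr0.
  by move=> x y Ox y0; rewrite (ricci_dim1 oO fF Ox y0) subrr !mul0r.
have n1_neq0 : n%:R - 1 != 0 :> R.
  by rewrite subr_eq0 -(mulr1n 1) eqr_nat gtn_eqF.
have ricciE := ricci_spherical n_gt1 oO hF hphi.
have F_neq0 x y : Omega x -> y != 0 -> F x y != 0.
  move=> Ox y0; rewrite F_eq // mulf_neq0 ?enorm_neq0 //.
  by rewrite lt0r_neq0 ?phi_gt0.
split=> [[K KE]|[K KE]].
  (* Radiality of [K] is bypassed: [Kr r] is the value of [K] at one chosen point [z] of norm [r],
     and the required equation at [(r, s)] is the Einstein equation at [z] in a direction [w] with
     angle [s]. *)
  have [Kr KrP] : {Kr : R -> R | forall x, Omega x -> x != 0 ->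
      exists2 z, Omega z /\ enorm z = enorm x & Kr (enorm x) = K z}.
    pose P r (z : 'rV[R]_n) := [/\ Omega z & enorm z = r].
    exists (fun r => K (get (P r))) => x Ox x0;
      exists (get (P (enorm x))) => //.
    by have [] : P (enorm x) (get (P (enorm x))) by apply: getPex; exists x.
  exists Kr => r s rs; have s_le := rs_range_le rs.
  move: rs => [x [y [Ox x0 y0 [rE sE]]]].
  have [z [Oz zx] KrE] := KrP _ Ox x0.
  have z0 : z != 0 by rewrite -dotp_eq0 -sqr_enorm zx expf_neq0 ?enorm_neq0.
  have [w w0 zw] : exists2 w, w != 0 & dotp z w / enorm w = s.
    by apply: exists_angle => //; rewrite zx -rE.
  have w2 : enorm w ^+ 2 != 0 by rewrite expf_neq0 // enorm_neq0.
  apply: (mulfI w2).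
  have E := ricciE _ _ Oz z0 w0.
  rewrite (KE _ _ Oz w0) (F_eq _ _ Oz) zw zx -rE in E.
  rewrite -E -rE in KrE *; rewrite KrE.
  by move: (phi r s) (K z) (enorm w) => *; ring.
(* A reference direction. [rs_range] omits the origin, so [K 0] is unconstrained and the factor
   there is read off at [y1]; continuity makes it valid for every other [y]. *)
pose y1 : 'rV[R]_n := const_mx 1.
have y1_neq0 : y1 != 0.
  apply/rV0Pn; exists (Ordinal (ltnW n_gt1)); rewrite mxE; exact: oner_neq0.
exists (fun x => if x == 0 then ricci F 0 y1 / ((n%:R - 1) * F 0 y1 ^+ 2)
                 else K (enorm x)) => x y Ox y0.
have einstein z w : Omega z -> z != 0 -> w != 0 ->
    ricci F z w = (n%:R - 1) * K (enorm z) * F z w ^+ 2.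
  move=> Oz z0 w0; rewrite ricciE // KE; last by exists z, w.
  by rewrite F_eq //; ring.
case: eqVneq => [x0|x0]; last exact: einstein.
move: Ox; rewrite x0 => O0; have Fy1 := F_neq0 _ _ O0 y1_neq0.
have Fy12 : F 0 y1 ^+ 2 != 0 by rewrite expf_neq0.
have E : ricci F 0 y * F 0 y1 ^+ 2 = ricci F 0 y1 * F 0 y ^+ 2.
  apply: (ricci_ratio_origin oO hF O0 y0 y1_neq0) => z Oz z0.
  rewrite (einstein _ _ Oz z0 y0) (einstein _ _ Oz z0 y1_neq0).
  by move: (F z y) (F z y1) (K _) => *; ring.
apply: (mulIf Fy12); apply: etrans E _.
by move: (ricci F 0 y1) (F 0 y1) (F 0 y) Fy1 => a b c b0;
  field; rewrite b0 n1_neq0.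
Qed.
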